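(* If $Q$ is a Dynkin quiver and $\mathbf d$ is a real root of $Q$, then the discriminant in $\mathrm{Rep}(Q,\mathbf d)$ is a linear free divisor.
   Context: $k$ is an algebraically closed field of characteristic zero. A quiver $Q$ is a finite directed graph with node set $Q_0$, arrow set $Q_1$, and head and tail maps $h,t:Q_1\to Q_0$. It is a Dynkin quiver if its underlying undirected graph is a disjoint union of Dynkin diagrams of types $A_n,D_n,E_6,E_7,E_8$. For $\mathbf d\in\mathbb N^{Q_0}$, $\mathrm{Rep}(Q,\mathbf d)=\prod_{\varphi\in Q_1}\mathrm{Hom}_k(k^{\mathbf d(t\varphi)},k^{\mathbf d(h\varphi)})$, acted on by $\mathrm{Gl}(Q,\mathbf d)=\prod_{x}\mathrm{Gl}_{\mathbf d(x)}(k)$ via $(g\cdot V)(\varphi)=g_{h\varphi}V(\varphi)g_{t\varphi}^{-1}$. $\mathbf d$ is a root if $\mathrm{Rep}(Q,\mathbf d)$ contains an indecomposable representation, and a real root if it contains exactly one orbit of indecomposables. The Tits form is $q(\mathbf d)=\sum_{x}\mathbf d(x)^2-\sum_{\varphi}\mathbf d(t\varphi)\mathbf d(h\varphi)$; for Dynkin quivers every root has $q(\mathbf d)=1$. Discriminant: let $R=k[\mathrm{Rep}(Q,\mathbf d)]$ be the coordinate ring, $\theta_R=\mathrm{Der}_k(R)\cong\mathrm{Rep}(Q,\mathbf d)\otimes_kR$, $\mathfrak{pgl}(Q,\mathbf d)=\prod_x\mathrm{End}(k^{\mathbf d(x)})/k$ (quotient by diagonal scalars), and let $M$ be the universal representation,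 whose matrices $M(\varphi)$ are the matrices of coordinate functions. The map $\tilde d^M_M:\mathfrak{pgl}(Q,\mathbf d)\otimes_kR\to\theta_R$ is induced by $(\psi_x)_x\mapsto(\psi_{h\varphi}M(\varphi)-M(\varphi)\psi_{t\varphi})_{\varphi}$. When $q(\mathbf d)=1$ it is a square matrix. The discriminant $D$ is the divisor defined by $\Delta=\det(\tilde d^M_M)$; as a set it consists of the $V$ with $\mathrm{Ext}^1_Q(V,V)\neq0$ (non-rigid representations). A reduced hypersurface $D$ in an affine space with coordinate ring $R$ is a linear free divisor if $\mathrm{Der}(-\log D)=\{\chi\in\mathrm{Der}_k(R):\chi(I_D)\subseteq I_D\}$ is a free $R$-module with a basis of vector fields all of whose coefficients are linear forms in the coordinates. (If $\mathrm{Rep}(Q,\mathbf d)=0$ the discriminant is empty and the statement is vacuous.) *)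

(* Defs.v *)
From HB Require Import structures.
From mathcomp Require Import all_boot all_order all_algebra.
From mathcomp Require Import mpoly.

Set Implicit Arguments.
Unset Strict Implicit.
Unset Printing Implicit Defensive.

Import GRing.Theory.
Local Open Scope ring_scope.

Record quiver := Quiver {
  node : finType;
  arrow : finType;
  head : arrow -> node;
  tail : arrow -> node
}.

Definition dimvec (Q : quiver) := node Q -> nat.

(** ** Dynkin quivers *)

Inductive dynkin_type :=
  | TypeA (n : nat) of (0 < n)%N
  | TypeD (n : nat) of (3 < n)%N
  | TypeE (n : nat) of (5 < n < 9)%N.

Definition dynkin_rank (T : dynkin_type) : nat :=
  match T with TypeA n _ | TypeD n _ | TypeE n _ => n end.

(* The nodes are 0, ..., n-1.  In type A they form a path.  In types D and E
   the nodes 0, ..., n-2 form a path and n-1 is joined to the branch node,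
   which is n-3 in type D and 2 in type E. *)
Definition dynkin_edge (T : dynkin_type) (i j : nat) : bool :=
  match T with
  | TypeA n _ => j == i.+1
  | TypeD n _ => ((j == i.+1) && (j < n.-1)%N) || ((i == n - 3)%N && (j == n.-1))
  | TypeE n _ => ((j == i.+1) && (j < n.-1)%N) || ((i == 2%N) && (j == n.-1))
  end.

Definition dynkin_adj (T : dynkin_type) (i j : nat) : bool :=
  dynkin_edge T i j || dynkin_edge T j i.

Definition dynkin_union_node (m : nat) (T : 'I_m -> dynkin_type) : finType :=
  {c : 'I_m & 'I_(dynkin_rank (T c))}.

Definition dynkin_union_adj (m : nat) (T : 'I_m -> dynkin_type)
    (u v : dynkin_union_node T) : bool :=
  (tag u == tag v) && dynkin_adj (T (tag u)) (tagged u) (tagged v).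

(* Counting arrows excludes loops and multiple edges. *)
Definition edge_mult (Q : quiver) (x y : node Q) : nat :=
  #|[set a : arrow Q | ((tail a == x) && (head a == y))
                    || ((tail a == y) && (head a == x))]|.

Definition dynkin_quiver (Q : quiver) : Prop :=
  exists (m : nat) (T : 'I_m -> dynkin_type) (f : node Q -> dynkin_union_node T),
    bijective f /\
    forall x y : node Q, edge_mult x y = dynkin_union_adj (f x) (f y) :> nat.

(** ** Representations *)

(* Matrices act on column vectors, so [A *m B] is the composite A o B. *)
Definition rep (k : fieldType) (Q : quiver) (d : dimvec Q) : Type :=
  forall a : arrow Q, 'M[k]_(d (head a), d (tail a)).

Definition same_orbit (k : fieldType) (Q : quiver) (d : dimvec Q)
    (V W : rep k d) : Prop :=
  exists g : forall x : node Q, 'M[k]_(d x),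
    (forall x, g x \in unitmx) /\
    (forall a, W a = g (head a) *m V a *m invmx (g (tail a))).

(* Isomorphism between representations whose dimension vectors need not be
   syntactically equal. *)
Definition rep_iso (k : fieldType) (Q : quiver) (d e : dimvec Q)
    (V : rep k d) (W : rep k e) : Prop :=
  exists (g : forall x : node Q, 'M[k]_(e x, d x))
         (g' : forall x : node Q, 'M[k]_(d x, e x)),
    [/\ forall x, g x *m g' x = 1%:M,
        forall x, g' x *m g x = 1%:M &
        forall a, g (head a) *m V a = W a *m g (tail a)].

Definition rep_sum (k : fieldType) (Q : quiver) (d e : dimvec Q)
    (V : rep k d) (W : rep k e) : rep k (fun x => (d x + e x)%N) :=
  fun a => block_mx (V a) 0 0 (W a).

Definition indecomposable (k : fieldType) (Q : quiver) (d : dimvec Q)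
    (V : rep k d) : Prop :=
  (exists x, d x <> 0%N) /\
  forall (d1 d2 : dimvec Q) (V1 : rep k d1) (V2 : rep k d2),
    rep_iso V (rep_sum V1 V2) ->
    (forall x, d1 x = 0%N) \/ (forall x, d2 x = 0%N).

Definition real_root (k : fieldType) (Q : quiver) (d : dimvec Q) : Prop :=
  exists V : rep k d, indecomposable V /\
    forall W : rep k d, indecomposable W -> same_orbit V W.

(** ** The discriminant *)

Definition rep_coord (Q : quiver) (d : dimvec Q) : finType :=
  {a : arrow Q & 'I_(d (head a)) * 'I_(d (tail a))}%type.

Definition rep_dim (Q : quiver) (d : dimvec Q) : nat := #|rep_coord d|.

Definition coord_ring (k : fieldType) (Q : quiver) (d : dimvec Q) :=
  {mpoly k[rep_dim d]}.

Definition universal_rep (k : fieldType) (Q : quiver) (d : dimvec Q)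
    (a : arrow Q) : 'M[coord_ring k d]_(d (head a), d (tail a)) :=
  \matrix_(i, j) 'X_(enum_rank (Tagged (fun a : arrow Q =>
    ('I_(d (head a)) * 'I_(d (tail a)))%type) (i, j) : rep_coord d)).

Definition gl (A : nzRingType) (Q : quiver) (d : dimvec Q) : Type :=
  forall x : node Q, 'M[A]_(d x).

Definition gl_ext (k : fieldType) (Q : quiver) (d : dimvec Q)
    (psi : gl k d) : gl (coord_ring k d) d :=
  fun x => map_mx (fun c => c%:MP) (psi x).

(* The map dtilde^M_M on lifts to gl; it vanishes on the diagonal scalars,
   hence factors through pgl (see [dtilde_scalar]). *)
Definition dtilde (k : fieldType) (Q : quiver) (d : dimvec Q)
    (psi : gl (coord_ring k d) d) (a : arrow Q) :
    'M[coord_ring k d]_(d (head a), d (tail a)) :=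
  psi (head a) *m universal_rep k d a - universal_rep k d a *m psi (tail a).

Lemma dtilde_scalar (k : fieldType) (Q : quiver) (d : dimvec Q)
    (r : coord_ring k d) (a : arrow Q) :
  dtilde (fun x => r%:M) a = 0.
Proof. by rewrite /dtilde mul_scalar_mx mul_mx_scalar subrr. Qed.

(* [b] consists of lifts to gl of a basis of pgl, the quotient of gl by the
   diagonal scalars. *)
Definition pgl_basis (k : fieldType) (Q : quiver) (d : dimvec Q) (n : nat)
    (b : 'I_n -> gl k d) : Prop :=
  (forall psi : gl k d, exists (c : 'I_n -> k) (s : k),
     forall x, psi x = \sum_i c i *: b i x + s%:M) /\
  (forall (c : 'I_n -> k) (s : k),
     (forall x, \sum_i c i *: b i x = s%:M) -> forall i, c i = 0).

Definition dtilde_mx (k : fieldType) (Q : quiver) (d : dimvec Q)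
    (b : 'I_(rep_dim d) -> gl k d) : 'M[coord_ring k d]_(rep_dim d) :=
  \matrix_(j, i) let c : rep_coord d := enum_val j in
    dtilde (gl_ext (b i)) (tag c) (tagged c).1 (tagged c).2.

(* The determinant depends on the basis of pgl only up to a nonzero constant,
   so the divisor it defines does not depend on this choice. *)
Definition discriminant_eq (k : fieldType) (Q : quiver) (d : dimvec Q)
    (Delta : coord_ring k d) : Prop :=
  exists b : 'I_(rep_dim d) -> gl k d,
    pgl_basis b /\ Delta = \det (dtilde_mx b).

(** ** Linear free divisors *)

Definition in_principal (R : comNzRingType) (f p : R) : Prop :=
  exists r, p = r * f.

Definition reduced_hypersurface (k : fieldType) (n : nat)
    (f : {mpoly k[n]}) : Prop :=
  [/\ f <> 0, f \isn't a GRing.unit &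
      forall (p : {mpoly k[n]}) (e : nat),
        in_principal f (p ^+ e) -> in_principal f p].

Definition derivation (k : fieldType) (n : nat)
    (chi : {mpoly k[n]} -> {mpoly k[n]}) : Prop :=
  (forall (c : k) p q, chi (c *: p + q) = c *: chi p + chi q) /\
  (forall p q, chi (p * q) = chi p * q + p * chi q).

(* Der(-log D) for the divisor D with ideal I_D = (f). *)
Definition der_log (k : fieldType) (n : nat) (f : {mpoly k[n]})
    (chi : {mpoly k[n]} -> {mpoly k[n]}) : Prop :=
  derivation chi /\ forall p, in_principal f p -> in_principal f (chi p).

Definition der_log_basis (k : fieldType) (n : nat) (f : {mpoly k[n]})
    (m : nat) (delta : 'I_m -> {mpoly k[n]} -> {mpoly k[n]}) : Prop :=
  [/\ forall i, der_log f (delta i),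
      forall chi, der_log f chi -> exists r : 'I_m -> {mpoly k[n]},
        forall p, chi p = \sum_i r i * delta i p &
      forall r : 'I_m -> {mpoly k[n]},
        (forall p, \sum_i r i * delta i p = 0) -> forall i, r i = 0].

(* The coefficients of a vector field chi are its values chi 'X_j. *)
Definition linear_free_divisor (k : fieldType) (n : nat)
    (f : {mpoly k[n]}) : Prop :=
  reduced_hypersurface f /\
  exists (m : nat) (delta : 'I_m -> {mpoly k[n]} -> {mpoly k[n]}),
    der_log_basis f delta /\ forall i j, delta i 'X_j \is 1.-homog.

(* Main.v *)
(** Let v be an indecomposable representation.  Positivity of the Tits form
    makes it a rigid brick, so that Delta(v) <> 0, and for the generic direction
    v the polynomial P(T) = Delta(x + T v) is, up to a unit, monic.  Everything
    follows once P is shown to be separable over the field of rational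
    functions: then Delta | p^e implies Delta | p, and Delta | h dDelta/dx_j for
    all j implies Delta | h, which is what Saito's criterion needs.

    Let z be a root of P in an extension L and W = x + z v, a representation
    over L.  Over any field every representation is a sum of rigid ones, and
    rigid representations over L are defined over k; hence W = g V g^-1 with V
    defined over k.  Differentiating this equation in the direction x_j shows
    that the orbit of W together with v spans all tangent directions.  As
    Delta(W) = 0, W = W1 + W2 is decomposable; let psi be the projection onto
    W1.  If z were a multiple root, [psi, v] would be tangent to the orbit of W,
    which forces Ext(W1, W2) = Ext(W2, W1) = 0, whence the contradiction
    1 = q(d) >= q(d1) + q(d2) >= 2. *)
Require Import Defs.
From HB Require Import structures.
From mathcomp Require Import all_boot all_order all_algebra.
From mathcomp Require Import mpoly.
From mathcomp Require Import falgebra fieldext separable.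
From mathcomp Require Import zify ring lra.
From Stdlib Require Import Classical.

Set Implicit Arguments.
Unset Strict Implicit.
Unset Printing Implicit Defensive.

Import Defs GRing.Theory.
Local Open Scope ring_scope.

(** * Representations of quivers *)

(** The obstacle is that nothing is known beforehand about the components of the discriminant, while
    reducedness concerns their generic points. A root z of P is such a point, but it lives over a
    finite extension L of the fraction field of the coordinate ring, and L need not be algebraically
    closed. Representations are therefore studied over arbitrary fields. There a brick can have more
    endomorphisms than the scalars, so that q(d) > 0 does not give Ext(V, V) = 0 by a dimension
    count alone. Descent to k matters because the partial derivatives, extended to functions of z,
    kill the entries of V: only g is differentiated, and its derivative yields tangent vectors of
    the orbit. Characteristic zero provides infinitely many constants in k for the descent, and
    makes it possible to extend derivations to z. Monicity of P stands in for Gauss's lemma: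
    divisibility by P over the fraction field descends to polynomials in T over the coordinate ring,
    and T = 0 turns it into divisibility by Delta. *)

Definition is_hom (K : fieldType) (Q : quiver) (d e : dimvec Q)
    (V : rep K d) (W : rep K e) (g : forall x, 'M[K]_(e x, d x)) : Prop :=
  forall a, g (head a) *m V a = W a *m g (tail a).

(** Ext^1(V, W) is the cokernel of g |-> g V - W g, by the standard resolution of length one of a
    quiver representation. *)
Definition ext_vanishes (K : fieldType) (Q : quiver) (d e : dimvec Q)
    (V : rep K d) (W : rep K e) : Prop :=
  forall xi : forall a, 'M[K]_(e (head a), d (tail a)),
  exists g : forall x, 'M[K]_(e x, d x),
  forall a, g (head a) *m V a - W a *m g (tail a) = xi a.

(** The endomorphism ring is a division ring, possibly larger than the scalars since [K] need not be
    algebraically closed. *)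
Definition brick (K : fieldType) (Q : quiver) (d : dimvec Q) (V : rep K d) :
    Prop :=
  forall g, is_hom V V g ->
    (forall x, g x = 0) \/ (forall x, g x \in unitmx).

Definition tits_positive (Q : quiver) : Prop :=
  forall d : dimvec Q, (exists x, d x <> 0%N) ->
    (\sum_a d (tail a) * d (head a) < \sum_x d x ^ 2)%N.

Definition total_dim (Q : quiver) (d : dimvec Q) : nat := (\sum_x d x)%N.

Lemma total_dim_eq0 (Q : quiver) (d : dimvec Q) :
  total_dim d = 0%N -> forall x, d x = 0%N.
Proof. by move=> /eqP; rewrite sum_nat_eq0 => /forallP h x; apply/eqP/h. Qed.

Lemma total_dim_gt0 (Q : quiver) (d : dimvec Q) :
  (exists x, d x <> 0%N) -> (0 < total_dim d)%N.
Proof. by case=> x dx; rewrite lt0n; apply/eqP => /total_dim_eq0/(_ x). Qed.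

Lemma is_hom_comp (K : fieldType) (Q : quiver) (d1 d2 d3 : dimvec Q)
    (V1 : rep K d1) (V2 : rep K d2) (V3 : rep K d3) g f :
  is_hom V2 V3 g -> is_hom V1 V2 f -> is_hom V1 V3 (fun x => g x *m f x).
Proof. by move=> hg hf a; rewrite -mulmxA hf !mulmxA hg. Qed.

Lemma rep_iso_sym (K : fieldType) (Q : quiver) (d e : dimvec Q)
    (V : rep K d) (W : rep K e) : rep_iso V W -> rep_iso W V.
Proof.
case=> g [g' [gK g'K hg]]; exists g', g; split=> // a.
by rewrite -[g' _ *m _]mulmx1 -gK mulmxA -(mulmxA _ (W a)) -hg !mulmxA g'K
  mul1mx.
Qed.

Lemma rep_iso_trans (K : fieldType) (Q : quiver) (d1 d2 d3 : dimvec Q)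
    (V1 : rep K d1) (V2 : rep K d2) (V3 : rep K d3) :
  rep_iso V1 V2 -> rep_iso V2 V3 -> rep_iso V1 V3.
Proof.
case=> g [g' [gK g'K hg]] [f [f' [fK f'K hf]]].
exists (fun x => f x *m g x), (fun x => g' x *m f' x); split=> [x|x|].
- by rewrite mulmxA -(mulmxA (f x)) gK mulmx1.
- by rewrite mulmxA -(mulmxA (g' x)) f'K mulmx1.
- exact: is_hom_comp hf hg.
Qed.

Lemma rep_iso_refl (K : fieldType) (Q : quiver) (d : dimvec Q) (V : rep K d) :
  rep_iso V V.
Proof.
by exists (fun x => 1%:M), (fun x => 1%:M); split=> *; rewrite ?mulmx1 ?mul1mx.
Qed.

Lemma mx_iso_dim (K : fieldType) m n (A : 'M[K]_(m, n)) B :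
  A *m B = 1%:M -> B *m A = 1%:M -> m = n.
Proof.
move=> AB BA; apply/eqP; rewrite eqn_leq -{1}(mxrank1 K m) -AB.
rewrite (leq_trans (mxrankM_maxl _ _)) ?rank_leq_col //=.
by rewrite -(mxrank1 K n) -BA (leq_trans (mxrankM_maxl _ _)) ?rank_leq_col.
Qed.

Lemma rep_iso_dim (K : fieldType) (Q : quiver) (d e : dimvec Q)
    (V : rep K d) (W : rep K e) : rep_iso V W -> forall x, d x = e x.
Proof. by case=> g [g' [gK g'K _]] x; apply: mx_iso_dim (g'K x) (gK x). Qed.

Lemma rep_iso_sum (K : fieldType) (Q : quiver) (d1 d2 e1 e2 : dimvec Q)
    (V1 : rep K d1) (V2 : rep K d2) (W1 : rep K e1) (W2 : rep K e2) :
  rep_iso V1 W1 -> rep_iso V2 W2 -> rep_iso (rep_sum V1 V2) (rep_sum W1 W2).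
Proof.
case=> g [g' [gK g'K hg]] [f [f' [fK f'K hf]]].
exists (fun x => block_mx (g x) 0 0 (f x)), (fun x => block_mx (g' x) 0 0 (f' x)).
split=> *; rewrite /rep_sum !mulmx_block !mulmx0 !mul0mx !addr0 !add0r.
- by rewrite gK fK -scalar_mx_block.
- by rewrite g'K f'K -scalar_mx_block.
- by rewrite hg hf.
Qed.

Lemma idem_base (K : fieldType) m n (C : 'M[K]_(m, n)) (R : 'M[K]_(n, m)) :
  row_full C -> row_free R -> (C *m R) *m (C *m R) = C *m R -> R *m C = 1%:M.
Proof.
move=> fC fR ee.
have : pinvmx C *m ((C *m R) *m (C *m R)) *m pinvmx R
       = pinvmx C *m (C *m R) *m pinvmx R by rewrite ee.
move: (mulVpmx fC) (mulmxVp fR); move: (pinvmx C) (pinvmx R) => C' R' hC hR.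
by rewrite !mulmxA hC !mul1mx -!mulmxA hR !mulmx1.
Qed.

(** Presents the images of a family. Matrices act on columns, so [row_full] makes [C x] injective
    and [row_free] makes [R x] surjective. *)
Lemma rank_factorization (K : fieldType) (I : Type) (m n : I -> nat)
    (A : forall x, 'M[K]_(m x, n x)) :
  exists (r : I -> nat) (C : forall x, 'M[K]_(m x, r x))
      (R : forall x, 'M[K]_(r x, n x)),
    [/\ forall x, C x *m R x = A x, forall x, row_full (C x),
        forall x, row_free (R x) & forall x, r x = \rank (A x)].
Proof.
exists (fun x => \rank (A x)), (fun x => col_base (A x)).
exists (fun x => row_base (A x)).
by split=> // x; rewrite ?mulmx_base ?col_base_full ?row_base_free.
Qed.

Lemma split_idem (K : fieldType) (Q : quiver) (d : dimvec Q) (V : rep K d)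
    (e : forall x, 'M[K]_(d x)) :
  is_hom V V e -> (forall x, e x *m e x = e x) ->
  exists (d' : dimvec Q) (U : rep K d') i p,
    [/\ is_hom U V i, is_hom V U p, forall x, i x *m p x = e x
      & forall x, p x *m i x = 1%:M].
Proof.
move=> he ee; have [r [C [R [CR fC fR _]]]] := rank_factorization e.
have RC x : R x *m C x = 1%:M by apply: idem_base; rewrite ?CR.
exists r, (fun a => R (head a) *m V a *m C (tail a)), C, R.
split=> [a|a|x|x] //.
- by rewrite !mulmxA CR he -mulmxA -CR -(mulmxA (C _)) RC mulmx1.
- by rewrite -!mulmxA CR -he mulmxA -CR mulmxA RC mul1mx.
Qed.

Lemma summand_complement (K : fieldType) (Q : quiver) (d e : dimvec Q)
    (V : rep K d) (U : rep K e) i p :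
  is_hom U V i -> is_hom V U p -> (forall x, p x *m i x = 1%:M) ->
  exists (e' : dimvec Q) (U' : rep K e') g g',
    [/\ forall x, g x *m g' x = 1%:M, forall x, g' x *m g x = 1%:M,
        is_hom V (rep_sum U U') g & forall x, (d x = e x + e' x)%N].
Proof.
move=> hi hp pi.
have [||e' [U' [i' [p' [hi' hp' ip' pi']]]]] :=
    @split_idem K Q d V (fun x => 1%:M - i x *m p x).
- by move=> a; rewrite mulmxBl mulmxBr mul1mx mulmx1 -mulmxA hp !mulmxA hi.
- move=> x; rewrite mulmxBl mul1mx mulmxBr mulmx1 !mulmxA -(mulmxA (i x)) pi.
  by rewrite mulmx1 subrr subr0.
have pi'0 x : p x *m i' x = 0.
  rewrite -[i' x]mulmx1 -pi' !mulmxA -(mulmxA (p x)) ip' mulmxBr mulmx1 mulmxA.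
  by rewrite pi mul1mx subrr mul0mx.
have p'i0 x : p' x *m i x = 0.
  rewrite -[p' x]mul1mx -pi' -(mulmxA (p' x)) ip' mulmxBr mulmx1 mulmxBl.
  by rewrite -!mulmxA pi mulmx1 subrr.
pose g x := col_mx (p x) (p' x); pose g' x := row_mx (i x) (i' x).
have gK x : g x *m g' x = 1%:M.
  by rewrite mul_col_row pi pi'0 p'i0 pi' -scalar_mx_block.
have g'K x : g' x *m g x = 1%:M.
  by rewrite mul_row_col ip' addrC subrK.
exists e', U', g, g'; split=> // [a|x]; last exact: mx_iso_dim (g'K x) (gK x).
by rewrite mul_col_mx hp hp' /rep_sum mul_block_col !mul0mx addr0 add0r.
Qed.

Lemma indecomposable_summand (K : fieldType) (Q : quiver) (d e : dimvec Q)
    (V : rep K d) (U : rep K e) i p :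
  indecomposable V -> (exists x, e x <> 0%N) ->
  is_hom U V i -> is_hom V U p -> (forall x, p x *m i x = 1%:M) ->
  forall x, d x = e x.
Proof.
move=> [_ indV] [y ey] hi hp pi x.
have [e' [U' [g [g' [gK g'K hg dE]]]]] := summand_complement hi hp pi.
have [|h|h] := indV _ _ U U'; first by exists g, g'.
- by have := h y.
- by rewrite dE h addn0.
Qed.

Lemma not_indecomposable (K : fieldType) (Q : quiver) (d : dimvec Q)
    (V : rep K d) :
  (exists x, d x <> 0%N) -> ~ indecomposable V ->
  exists (d1 d2 : dimvec Q) (V1 : rep K d1) (V2 : rep K d2),
    [/\ rep_iso V (rep_sum V1 V2), exists x, d1 x <> 0%N
      & exists x, d2 x <> 0%N].
Proof.
move=> d0 nind; apply: NNPP => h; apply: nind; split=> // d1 d2 V1 V2 iso.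
apply: NNPP => /not_or_and[/not_all_ex_not h1 /not_all_ex_not h2].
by apply: h; exists d1, d2, V1, V2.
Qed.

(** * Families of matrices as row vectors; Hom and Ext as kernel and cokernel of one matrix *)

Section FamilyVectors.
Variables (R : comNzRingType) (I : finType) (m n : I -> nat).

Definition fam_idx : finType := {i : I & 'I_(m i) * 'I_(n i)}%type.

Definition fam_vec (F : forall i, 'M[R]_(m i, n i)) : 'rV[R]_#|fam_idx| :=
  \row_j F (tag (enum_val j)) (tagged (enum_val j)).1 (tagged (enum_val j)).2.

Definition fam_of_vec (v : 'rV[R]_#|fam_idx|) i : 'M[R]_(m i, n i) :=
  \matrix_(a, b) v 0 (enum_rank
    (Tagged (fun i => ('I_(m i) * 'I_(n i))%type) (a, b) : fam_idx)).

Lemma fam_vecK F i : fam_of_vec (fam_vec F) i = F i.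
Proof. by apply/matrixP=> a b; rewrite !mxE enum_rankK. Qed.

Lemma fam_of_vecK v : fam_vec (fam_of_vec v) = v.
Proof.
apply/rowP=> j; rewrite !mxE -[in RHS](enum_valK j).
by case: (enum_val j) => i [a b].
Qed.

Lemma fam_vec_eq F G : (forall i, F i = G i) -> fam_vec F = fam_vec G.
Proof. by move=> FG; apply/rowP=> j; rewrite !mxE FG. Qed.

Lemma fam_vec_inj F G : fam_vec F = fam_vec G -> forall i, F i = G i.
Proof. by move=> FG i; rewrite -(fam_vecK F) FG fam_vecK. Qed.

Lemma fam_vecD F G :
  fam_vec (fun i => F i + G i) = fam_vec F + fam_vec G.
Proof. by apply/rowP=> j; rewrite !mxE. Qed.

Lemma fam_vecZ c F : fam_vec (fun i => c *: F i) = c *: fam_vec F.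
Proof. by apply/rowP=> j; rewrite !mxE. Qed.

Lemma fam_of_vecD u v i : fam_of_vec (u + v) i = fam_of_vec u i + fam_of_vec v i.
Proof. by apply/matrixP=> a b; rewrite !mxE. Qed.

Lemma fam_of_vecZ c v i : fam_of_vec (c *: v) i = c *: fam_of_vec v i.
Proof. by apply/matrixP=> a b; rewrite !mxE. Qed.

Lemma fam_of_vec_sum (J : finType) (v : J -> 'rV_#|fam_idx|) i :
  fam_of_vec (\sum_j v j) i = \sum_j fam_of_vec (v j) i.
Proof.
apply/matrixP=> a b; rewrite !mxE summxE summxE.
by apply: eq_bigr => j _; rewrite mxE.
Qed.

Lemma fam_of_vec0 i : fam_of_vec 0 i = 0.
Proof. by apply/matrixP=> a b; rewrite !mxE. Qed.

Lemma card_fam_idx : #|fam_idx| = (\sum_i m i * n i)%N.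
Proof.
rewrite card_tagged sumnE big_map big_enum /=; apply: eq_bigr => i _.
by rewrite card_prod !card_ord.
Qed.

End FamilyVectors.

Lemma linear_row_mx (R : comNzRingType) m n (f : 'rV[R]_m -> 'rV[R]_n) :
  linear f -> exists M, forall u, f u = u *m M.
Proof.
move=> lf; have f0 : f 0 = 0.
  by have := lf (-1) 0 0; rewrite scaleN1r oppr0 addr0 scaleN1r addNr.
exists (\matrix_i f (delta_mx 0 i)) => u.
rewrite mulmx_sum_row {1}(row_sum_delta u).
elim/big_rec2: _ => [|i v w _ <-]; first exact: f0.
by rewrite lf rowK.
Qed.

(** The left kernel of [L] is Hom(V, W) and its cokernel is Ext(V, W), so that dimension counts
    become rank counts. *)
Lemma hom_defect_mx (K : fieldType) (Q : quiver) (d e : dimvec Q)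
    (V : rep K d) (W : rep K e) :
  exists L, forall u, u *m L =
    fam_vec (fun a => fam_of_vec u (head a) *m V a
                      - W a *m fam_of_vec u (tail a)) :> 'rV[K]_#|fam_idx _ _|.
Proof.
suff /linear_row_mx[L LE] : linear (fun u : 'rV[K]_#|fam_idx e d| =>
    fam_vec (fun a => fam_of_vec u (head a) *m V a
                      - W a *m fam_of_vec u (tail a))) by exists L.
move=> c u v; rewrite -fam_vecZ -fam_vecD; apply: fam_vec_eq => a.
rewrite !(fam_of_vecD, fam_of_vecZ) mulmxDl mulmxDr -!scalemxAl -!scalemxAr.
by rewrite scalerBr opprD addrACA.
Qed.

Lemma ext_vanishes_row_full (K : fieldType) (Q : quiver) (d e : dimvec Q)
    (V : rep K d) (W : rep K e) L :
  (forall u, u *m L = fam_vec (fun a => fam_of_vec u (head a) *m V a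
                      - W a *m fam_of_vec u (tail a))) ->
  ext_vanishes V W -> row_full L.
Proof.
move=> LE ext; rewrite -sub1mx; apply/row_subP => i.
have [g gE] := ext (fam_of_vec (row i 1%:M)).
apply/submxP; exists (fam_vec g); rewrite LE -[LHS]fam_of_vecK.
by apply: fam_vec_eq => a; rewrite !fam_vecK gE.
Qed.

(** A surjective linear map cannot raise the dimension. In other words, the Euler form of (d, e) is
    then dim Hom(V, W), which is nonnegative. *)
Lemma ext_vanishes_euler (K : fieldType) (Q : quiver) (d e : dimvec Q)
    (V : rep K d) (W : rep K e) :
  ext_vanishes V W ->
  (\sum_a d (tail a) * e (head a) <= \sum_x d x * e x)%N.
Proof.
have [L LE] := hom_defect_mx V W; move=> /(ext_vanishes_row_full LE).
rewrite /row_full => /eqP rk; have := rank_leq_row L; rewrite rk.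
rewrite !card_fam_idx; under eq_bigr do rewrite mulnC.
by under [X in (_ <= X)%N]eq_bigr do rewrite mulnC.
Qed.

(* If [eta] were not in the image of [L : psi |-> [psi, V]], then
   [psi |-> [psi, V] + pi(psi) eta], with [pi] a projection onto [End V], would
   be injective, as [End V] is a division ring; this contradicts
   the positivity of the Tits form. *)
Lemma brick_rigid (K : fieldType) (Q : quiver) (d : dimvec Q) (V : rep K d) :
  tits_positive Q -> (exists x, d x <> 0%N) -> brick V -> ext_vanishes V V.
Proof.
move=> tits d0 brV eta; apply: NNPP => eta_im.
have [L LE] := hom_defect_mx V V.
have /linear_row_mx[M ME] : linear (fun u : 'rV[K]_#|fam_idx d d| =>
    fam_vec (fun a => fam_of_vec u (head a) *m eta a)).
  move=> c u v; rewrite -fam_vecZ -fam_vecD; apply: fam_vec_eq => a.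
  by rewrite !(fam_of_vecD, fam_of_vecZ) mulmxDl -!scalemxAl.
pose pi := 1%:M - L *m pinvmx L; pose G := L + pi *m M.
have piL : pi *m L = 0 by rewrite mulmxBl mul1mx mulmxKpV ?subrr.
have : ~~ row_free G.
  apply/negP => /eqP rk; have := rank_leq_col G; rewrite rk !card_fam_idx.
  apply/negP; rewrite -ltnNge; under eq_bigr do rewrite mulnC.
  by under [X in (_ < X)%N]eq_bigr do rewrite mulnn; apply: tits.
rewrite -kermx_eq0 => /rowV0Pn[u /sub_kermxP uG u0].
have homp : is_hom V V (fam_of_vec (u *m pi)).
  move=> a; apply/eqP; rewrite -subr_eq0; apply/eqP; move: a; apply: fam_vec_inj.
  rewrite -LE -mulmxA piL mulmx0; apply/esym.
  by apply/rowP=> j; rewrite !mxE.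
case: (brV _ homp) => [p0|pU].
- have up0 : u *m pi = 0.
    rewrite -[LHS]fam_of_vecK; apply/rowP=> j; rewrite mxE p0 !mxE //.
  move: uG; rewrite mulmxDr mulmxA up0 mul0mx addr0 => uL.
  move: up0; rewrite mulmxBr mulmx1 mulmxA uL mul0mx subr0 => up0.
  by rewrite up0 eqxx in u0.
(* The endomorphism p = pi(u) is now invertible and commutes with V, so [u, V] + p eta = 0 gives eta
   = [- p^-1 u, V]. *)
- apply: eta_im; exists (fun x => - (invmx (fam_of_vec (u *m pi) x) *m fam_of_vec u x)).
  move=> a; move: uG; rewrite mulmxDr mulmxA LE -ME -fam_vecD => uG.
  have {uG} := fam_vec_inj (etrans uG (esym (fam_of_vecK 0))) a.
  rewrite fam_of_vec0; move: (homp a) pU.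
  move: (fam_of_vec _) (fam_of_vec u) => p g pV pU /eqP; rewrite addrC addr_eq0 => /eqP.
  move=> /(congr1 (mulmx (invmx (p (head a))))); rewrite mulmxA mulVmx // mul1mx => ->.
  have Vp : V a *m invmx (p (tail a)) = invmx (p (head a)) *m V a.
    apply: (canRL (mulKmx (pU _))); rewrite mulmxA pV -mulmxA mulmxV ?mulmx1 //.
  by rewrite mulNmx !mulmxN mulmxBr opprK opprB !mulmxA Vp addrC.
Qed.

Lemma ext_vanishes_iso (K : fieldType) (Q : quiver) (d e : dimvec Q)
    (V : rep K d) (W : rep K e) :
  rep_iso V W -> ext_vanishes V V -> ext_vanishes W W.
Proof.
move=> iso ext xi; have [f' [f [f'K fK hf']]] := rep_iso_sym iso.
have [psi psiE] := ext (fun a => f' (head a) *m xi a *m f (tail a)).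
have Wf a : W a *m f (tail a) = f (head a) *m V a.
  rewrite -[LHS]mul1mx -fK -!mulmxA; congr (_ *m _).
  by rewrite mulmxA hf' -mulmxA f'K mulmx1.
exists (fun x => f x *m psi x *m f' x) => a.
rewrite -[RHS]mul1mx -[RHS]mulmx1 -!fK !mulmxA Wf -!mulmxA (mulmxA (xi a)).
rewrite (mulmxA (f' _) (xi _ *m _)) (mulmxA (f' _) (xi _)) -psiE mulmxBl mulmxBr.
by rewrite !mulmxA -(mulmxA _ (f' _) (W a)) hf' !mulmxA.
Qed.

(** * Indecomposable representations are bricks *)

Lemma ex_minimal (P : nat -> Prop) :
  (exists n, P n) -> exists2 n, P n & forall m, P m -> (n <= m)%N.
Proof.
case=> n; have [k] := ubnP n; elim: k n => // k IH n; rewrite ltnS => nk Pn.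
have [h|h] := classic (exists2 m, P m & (m < n)%N).
  by case: h => m Pm mn; apply: IH Pm; apply: leq_trans mn nk.
by exists n => // m Pm; rewrite leqNgt; apply/negP => mn; apply: h; exists m.
Qed.

Lemma eq_of_leq_sum (I : finType) (a r : I -> nat) :
  (forall x, (a x <= r x)%N) -> (\sum_x r x <= \sum_x a x)%N ->
  forall x, a x = r x.
Proof.
move=> ar; rewrite (bigID xpredT) /= big_pred0_eq addn0 => h x.
apply/eqP; rewrite eqn_leq ar /= leqNgt; apply/negP => lt.
move: h; rewrite leqNgt (bigD1 x) //= [X in (_ < X)%N](bigD1 x) //= => /negP[].
by rewrite -addSn leq_add // leq_sum.
Qed.

Lemma unitmx_of_rank (K : fieldType) n (A : 'M[K]_n) :
  \rank A = n -> A \in unitmx.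
Proof. by rewrite -row_free_unit /row_free => ->. Qed.

Lemma leq_mx_section (K : fieldType) m n (A : 'M[K]_(m, n)) B :
  A *m B = 1%:M -> (m <= n)%N.
Proof.
move=> AB; rewrite -{1}(mxrank1 K m) -AB.
by rewrite (leq_trans (mxrankM_maxl _ _)) ?rank_leq_col.
Qed.

Lemma mx_neq0_dim (K : fieldType) m n (A : 'M[K]_(m, n)) :
  A <> 0 -> m <> 0%N /\ n <> 0%N.
Proof.
move=> A0; split=> h; apply: A0; apply/matrixP=> i j.
  by case: i => i lti; exfalso; rewrite h in lti.
by case: j => j ltj; exfalso; rewrite h in ltj.
Qed.

Lemma family_neq0 (I : Type) (T : I -> zmodType) (F : forall i, T i) :
  ~ (forall i, F i = 0) -> exists i, F i <> 0.
Proof. exact: not_all_ex_not. Qed.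

Lemma is_hom_inv (K : fieldType) (Q : quiver) (d : dimvec Q) (V : rep K d) f :
  is_hom V V f -> (forall x, f x \in unitmx) ->
  is_hom V V (fun x => invmx (f x)).
Proof.
move=> hf uf a; apply: (canRL (mulmxK (uf _))).
by rewrite -mulmxA -hf mulmxA mulVmx ?mul1mx.
Qed.

(** Induction on the total dimension: the two projections of a decomposition are jointly injective,
    so one of them does not kill [f]. *)
Lemma indecomposable_component (K : fieldType) (Q : quiver) (c d : dimvec Q)
    (I : rep K c) (U : rep K d) f :
  is_hom I U f -> (exists x, f x <> 0) ->
  exists (d' : dimvec Q) (U' : rep K d') i p,
    [/\ is_hom U' U i, is_hom U U' p, forall x, p x *m i x = 1%:M,
        indecomposable U' & exists x, p x *m f x <> 0].
Proof.
have [n] := ubnP (total_dim d).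
elim: n d U f => // n IH d U f; rewrite ltnS => dn hf f0.
have d0 : exists x, d x <> 0%N.
  by have [x /mx_neq0_dim[dx _]] := f0; exists x.
have [indU|nindU] := classic (indecomposable U).
  exists d, U, (fun x => 1%:M), (fun x => 1%:M).
  split=> // *; rewrite ?mulmx1 ?mul1mx //.
  - by move=> ?; rewrite mulmx1 mul1mx.
  - by move=> ?; rewrite mulmx1 mul1mx.
  - by have [x fx] := f0; exists x; rewrite mul1mx.
have [d1 [d2 [V1 [V2 [iso d10 d20]]]]] := not_indecomposable d0 nindU.
have dE := rep_iso_dim iso.
have tdE : total_dim d = (total_dim d1 + total_dim d2)%N.
  by rewrite /total_dim -big_split; apply: eq_bigr => x _; rewrite dE.
have [g [g' [gK g'K hg]]] := iso.
have hg' : is_hom (rep_sum V1 V2) U g'.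
  move=> a; rewrite -[LHS]mulmx1 -gK !mulmxA -(mulmxA (g' _) (rep_sum _ _ _)).
  by rewrite -hg !mulmxA g'K mul1mx.
have hin1 : is_hom V1 (rep_sum V1 V2) (fun x => col_mx 1%:M 0).
  by move=> a; rewrite /rep_sum mul_col_mx mul_block_col
    !(mul0mx, mulmx0, mul1mx, mulmx1, addr0).
have hin2 : is_hom V2 (rep_sum V1 V2) (fun x => col_mx 0 1%:M).
  by move=> a; rewrite /rep_sum mul_col_mx mul_block_col
    !(mul0mx, mulmx0, mul1mx, mulmx1, add0r).
have hpr1 : is_hom (rep_sum V1 V2) V1 (fun x => row_mx 1%:M 0).
  by move=> a; rewrite /rep_sum mul_mx_row mul_row_block
    !(mul0mx, mulmx0, mul1mx, mulmx1, addr0).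
have hpr2 : is_hom (rep_sum V1 V2) V2 (fun x => row_mx 0 1%:M).
  by move=> a; rewrite /rep_sum mul_mx_row mul_row_block
    !(mul0mx, mulmx0, mul1mx, mulmx1, add0r).
have rec (e : dimvec Q) (W : rep K e) i p : (total_dim e < n)%N ->
    is_hom W (rep_sum V1 V2) i -> is_hom (rep_sum V1 V2) W p ->
    (forall x, p x *m i x = 1%:M) -> (exists x, p x *m g x *m f x <> 0) ->
    exists (d' : dimvec Q) (U' : rep K d') i p,
    [/\ is_hom U' U i, is_hom U U' p, forall x, p x *m i x = 1%:M,
        indecomposable U' & exists x, p x *m f x <> 0].
  move=> en hi hp pi pf0.
  have [|//|d' [U' [j [q [hj hq qj ind' qf0]]]]] :=
    IH _ W (fun x => p x *m g x *m f x) en.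
    exact: is_hom_comp (is_hom_comp hp hg) hf.
  exists d', U', (fun x => g' x *m i x *m j x), (fun x => q x *m (p x *m g x)).
  split=> //.
  - exact: is_hom_comp (is_hom_comp hg' hi) hj.
  - exact: is_hom_comp hq (is_hom_comp hp hg).
  - move=> x; rewrite !mulmxA -(mulmxA _ (g x)) gK mulmx1.
    by rewrite -(mulmxA (q x)) pi mulmx1 qj.
  - by have [x qfx] := qf0; exists x; rewrite -mulmxA.
have lt1 : (total_dim d1 < n)%N.
  by rewrite (leq_trans _ dn) // tdE -addn1 leq_add2l total_dim_gt0.
have lt2 : (total_dim d2 < n)%N.
  by rewrite (leq_trans _ dn) // tdE -add1n leq_add2r total_dim_gt0.
have [z1|/family_neq0 n1] :=
    classic (forall x, row_mx 1%:M 0 *m g x *m f x = 0 :> 'M[K]_(d1 x, c x)); last first.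
  apply: (rec _ V1 _ _ lt1 hin1 hpr1) => // x.
  by rewrite mul_row_col mulmx1 mulmx0 addr0.
have [z2|/family_neq0 n2] :=
    classic (forall x, row_mx 0 1%:M *m g x *m f x = 0 :> 'M[K]_(d2 x, c x)); last first.
  apply: (rec _ V2 _ _ lt2 hin2 hpr2) => // x.
  by rewrite mul_row_col mulmx1 mulmx0 add0r.
exfalso; have [x []] := f0; rewrite -[LHS]mul1mx -g'K -mulmxA.
suff -> : g x *m f x = 0 by rewrite mulmx0.
rewrite -[LHS]mul1mx scalar_mx_block /block_mx mul_col_mx !mulmxA z1 z2.
by rewrite col_mx0.
Qed.

(* Ringel's argument: for [theta] a nonzero endomorphism of minimal rank, its
   image I is a brick and embeds into an indecomposable summand K' of its
   kernel; K' being rigid by induction, Ext(I, K') = 0, whence K' would be a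
   proper direct summand of V. *)
Lemma indecomposable_brick (K : fieldType) (Q : quiver) (d : dimvec Q)
    (V : rep K d) : tits_positive Q -> indecomposable V -> brick V.
Proof.
move=> tits; have [n] := ubnP (total_dim d).
elim: n d V => // n IH d V; rewrite ltnS => dn indV.
apply: NNPP => nbr.
have [g [hg [/family_neq0 g0 /not_all_ex_not[y gy]]]] : exists g,
    is_hom V V g /\ (~ (forall x, g x = 0) /\ ~ (forall x, g x \in unitmx)).
  apply: NNPP => h; apply: nbr => g hg; apply: NNPP => /not_or_and hn.
  by apply: h; exists g.
pose rk (t : forall x, 'M[K]_(d x)) := (\sum_x \rank (t x))%N.
have [_ [th [hth th0 <-]] min_rk] : exists2 r,
    (exists t, [/\ is_hom V V t, exists x, t x <> 0 & rk t = r]) &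
    forall m, (exists t, [/\ is_hom V V t, exists x, t x <> 0 & rk t = m]) ->
      (r <= m)%N.
  by apply: ex_minimal; exists (rk g), g.
have {min_rk} min_rk t : is_hom V V t -> (exists x, t x <> 0) ->
    (rk th <= rk t)%N by move=> ht t0; apply: min_rk; exists t.
have rk_lt : (rk th < total_dim d)%N.
  apply: leq_ltn_trans (min_rk g hg g0) _; rewrite ltnNge; apply/negP => le.
  apply: gy; apply: unitmx_of_rank.
  by apply: (eq_of_leq_sum _ le) => x; apply: rank_leq_row.
have [r [i [p [ip fi fp rE]]]] := rank_factorization th.
have [i' i'K] : exists i' : forall x, 'M[K]_(r x, d x), forall x, i' x *m i x = 1%:M.
  by exists (fun x => pinvmx (i x)) => x; apply: mulVpmx.
have [s sK] : exists s : forall x, 'M[K]_(d x, r x), forall x, p x *m s x = 1%:M.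
  by exists (fun x => pinvmx (p x)) => x; apply: mulmxVp.
have rk_r : rk th = (\sum_x r x)%N by apply: eq_bigr => x _; rewrite rE.
have i_inj x m (A B : 'M_(r x, m)) : i x *m A = i x *m B -> A = B.
  by move=> /(congr1 (mulmx (i' x))); rewrite !mulmxA i'K !mul1mx.
have [I [hi hp]] : exists I : rep K r, is_hom I V i /\ is_hom V I p.
  exists (fun a => p (head a) *m V a *m s (tail a)).
  have hi a : i (head a) *m (p (head a) *m V a *m s (tail a)) = V a *m i (tail a).
    by rewrite !mulmxA ip hth -ip -!mulmxA sK mulmx1.
  by split=> // a; apply: i_inj; rewrite [RHS]mulmxA hi -mulmxA ip [LHS]mulmxA ip hth.
have r0 : exists x, r x <> 0%N.
  have [x thx] := th0; exists x => rx; apply: thx.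
  by apply/eqP; rewrite -mxrank_eq0 -rE rx.
(* A nonzero endomorphism phi of I gives the nonzero endomorphism i phi p of V, of rank at most that
   of phi; minimality forces phi to be invertible. *)
have brI : brick I.
  move=> phi hphi.
  have [|/family_neq0[x phix]] := classic (forall x, phi x = 0); first by left.
  right=> z; apply: unitmx_of_rank; move: z.
  apply: eq_of_leq_sum => [u|]; first exact: rank_leq_row.
  rewrite -rk_r.
  apply: leq_trans (min_rk (fun x => i x *m phi x *m p x) _ _) _.
  - exact: is_hom_comp (is_hom_comp hi hphi) hp.
  - exists x => h; apply: phix; apply: i_inj; rewrite mulmx0.
    by rewrite -[LHS]mulmx1 -sK mulmxA h mul0mx.
  - apply: leq_sum => u _; apply: leq_trans (mxrankM_maxl _ _) _.
    exact: mxrankM_maxr.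
(* Otherwise p i is invertible, so I is a direct summand of V and hence has the dimension of V,
   although theta does not have full rank. *)
have pi0 x : p x *m i x = 0.
  have [h|u] := brI _ (is_hom_comp hp hi); first exact: h.
  exfalso; move: rk_lt; rewrite rk_r ltnNge => /negP[]; apply: leq_sum => z _.
  have dr : forall x, d x = r x.
    apply: (indecomposable_summand indV r0 hi
      (is_hom_comp (is_hom_inv (is_hom_comp hp hi) u) hp)) => t.
    by rewrite -mulmxA mulVmx.
  by rewrite dr.
(* The section [s] is chosen node by node and need not be a morphism, hence neither need [e]. Its
   image is nonetheless a subrepresentation, being the kernel of [p]. *)
pose e x := 1%:M - s x *m p x.
have [c [k [k' [kk' fk fk' cE]]]] := rank_factorization e.
have pe x : p x *m e x = 0 by rewrite mulmxBr mulmx1 mulmxA sK mul1mx subrr.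
have ee x : e x *m e x = e x by rewrite {1}/e mulmxBl mul1mx -mulmxA pe mulmx0 subr0.
have k'k x : k' x *m k x = 1%:M by apply: idem_base; rewrite ?kk'.
have pk x : p x *m k x = 0 by rewrite -[k x]mulmx1 -k'k (mulmxA (k x)) kk' mulmxA pe mul0mx.
have [U hk] : exists U : rep K c, is_hom U V k.
  exists (fun a => k' (head a) *m V a *m k (tail a)) => a.
  rewrite !mulmxA kk' mulmxBl mul1mx mulmxBl -(mulmxA (s _)) hp -!mulmxA pk.
  by rewrite !mulmx0 subr0.
have kk'i x : k x *m (k' x *m i x) = i x.
  by rewrite mulmxA kk' mulmxBl mul1mx -mulmxA pi0 mulmx0 subr0.
have hf : is_hom I U (fun x => k' x *m i x).
  move=> a; rewrite -[RHS]mul1mx -k'k -!mulmxA (mulmxA (k _) (U a)) hk.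
  by rewrite -(mulmxA (V a)) kk'i hi.
have [|d' [U' [j [q [hj hq qj indU' qf0]]]]] := indecomposable_component hf.
  have [x rx] := r0; exists x => h; apply: rx.
  have /(congr1 mxrank) := i'K x.
  by rewrite -(kk'i x) h mulmx0 mulmx0 mxrank0 mxrank1.
have cd x : (c x <= d x)%N := leq_mx_section (k'k x).
have d'c x : (d' x <= c x)%N := leq_mx_section (qj x).
have lt_c : (total_dim c < total_dim d)%N.
  rewrite ltnNge; apply/negP => le; have cdE := eq_of_leq_sum cd le.
  have [x []] := th0; rewrite -ip.
  suff -> : p x = 0 by rewrite mulmx0.
  have : \rank (k x) = d x by rewrite -[RHS]cdE; apply/eqP/fk.
  move=> rkk; apply/eqP; rewrite -(mulmx_free_eq0 _ (B := k x)) ?pk //.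
  by rewrite /row_free rkk.
have lt_d' : (total_dim d' < total_dim d)%N.
  by apply: leq_ltn_trans lt_c; apply: leq_sum.
have [f [hf' [z fz0]]] : exists f, is_hom I U' f /\ exists z, f z <> 0.
  by exists (fun x => q x *m (k' x *m i x)); split=> //; apply: is_hom_comp hq hf.
(* Minimality once more: k j f p is a nonzero endomorphism of V factoring through f, so f is
   injective. *)
have f_full x : row_full (f x).
  apply/eqP; move: x; apply: eq_of_leq_sum => [x|]; first exact: rank_leq_col.
  rewrite -rk_r.
  apply: leq_trans (min_rk (fun x => k x *m j x *m f x *m p x) _ _) _.
  - exact: is_hom_comp (is_hom_comp (is_hom_comp hk hj) hf') hp.
  - exists z; have E (F : 'M_(d' z, r z)) :
        q z *m k' z *m (k z *m j z *m F *m p z) *m s z = F.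
      rewrite !mulmxA -(mulmxA (q z)) k'k mulmx1 qj mul1mx.
      by rewrite -mulmxA sK mulmx1.
    by move=> h; apply: fz0; rewrite -[LHS]E h mulmx0 mul0mx.
  - apply: leq_sum => x _; apply: leq_trans (mxrankM_maxl _ _) _.
    exact: mxrankM_maxr.
have rigU' : ext_vanishes U' U'.
  apply: brick_rigid tits _ _; first by case: indU'.
  exact: IH (leq_trans lt_d' dn) indU'.
(* The map q k' is a retraction of k j only node by node; [del] measures its failure to be a
   morphism. It vanishes on the kernel of p, hence factors through p and defines a class in Ext(I,
   U'). *)
have [del delE] : exists del, forall a,
    del a = q (head a) *m k' (head a) *m V a - U' a *m (q (tail a) *m k' (tail a)).
  by exists (fun a => q (head a) *m k' (head a) *m V a
    - U' a *m (q (tail a) *m k' (tail a))).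
have delk a : del a *m k (tail a) = 0.
  rewrite delE mulmxBl -!mulmxA k'k mulmx1 -hk (mulmxA (k' _)) k'k mul1mx.
  by rewrite hq subrr.
have delsp a : del a *m s (tail a) *m p (tail a) = del a.
  apply/esym/eqP; rewrite -subr_eq0 -{1}[del a]mulmx1 -mulmxA -mulmxBr -/(e _).
  by rewrite -kk' mulmxA delk mul0mx.
have [l lK] : exists l : forall x, 'M[K]_(r x, d' x), forall x, l x *m f x = 1%:M.
  by exists (fun x => pinvmx (f x)) => x; apply: mulVpmx.
(* The left inverse [l] of f extends the cocycle from I to U', where it is a coboundary because
   Ext(U', U') = 0; restricting the solution along f kills the class on I. *)
have [g' g'E] := rigU' (fun a => del a *m s (tail a) *m l (tail a)).
have {}g'E a : g' (head a) *m f (head a) *m I a - U' a *m (g' (tail a) *m f (tail a))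
    = del a *m s (tail a).
  by rewrite -mulmxA hf' !mulmxA -mulmxBl g'E -(mulmxA _ (l _)) lK mulmx1.
(* Subtracting g' f p turns q k' into a morphism, and it remains a retraction of k j because p k =
   0. *)
have dd' : forall x, d x = d' x.
  apply: (@indecomposable_summand K Q d d' V U' (fun x => k x *m j x)
    (fun x => q x *m k' x - g' x *m f x *m p x)) => //.
  - by case: indU'.
  - exact: is_hom_comp hk hj.
  - move=> a; apply/eqP; rewrite -subr_eq0 mulmxBl mulmxBr opprB addrACA.
    rewrite [X in _ + X]addrC addrACA.
    rewrite -delE -{1}delsp -g'E mulmxBl -(mulmxA _ (p _)) hp !mulmxA.
    by rewrite addrA subrK subrr.
  - move=> x; rewrite mulmxBl -!mulmxA (mulmxA (p x)) pk !(mul0mx, mulmx0) subr0.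
    by rewrite (mulmxA (k' x)) k'k mul1mx qj.
move: lt_d'; rewrite /total_dim; under eq_bigr do rewrite -dd'.
by rewrite ltnn.
Qed.

(** * Deformation of rigid representations and descent to a smaller field *)

Lemma map_fam_of_vec (R S : comNzRingType) (f : R -> S) (I : finType)
    (m n : I -> nat) v i :
  map_mx f (@fam_of_vec R I m n v i) = fam_of_vec (map_mx f v) i.
Proof. by apply/matrixP=> a b; rewrite !mxE. Qed.

Lemma map_horner_polyC (K : comNzRingType) m n (A : 'M[K]_(m, n)) t :
  map_mx (horner_eval t) (map_mx polyC A) = A.
Proof. by apply/matrixP=> i j; rewrite !mxE /horner_eval hornerC. Qed.

(* A right inverse of [psi |-> [psi, W]] solves [(1 + h) W = (W + t E) (1 + h)]
   for [h], by Cramer's rule rationally in [t] and with [h = 0] at [t = 0]. *)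
Lemma rigid_deform (K : fieldType) (Q : quiver) (d : dimvec Q) (W E : rep K d) :
  ext_vanishes W W ->
  exists2 p : {poly K}, p != 0 & forall t, ~~ root p t ->
    rep_iso W (fun a => W a + t *: E a).
Proof.
have [L LE] := hom_defect_mx W W; move=> /(ext_vanishes_row_full LE).
case/row_fullP=> S SL.
have /linear_row_mx[N NE] :
    linear (fun y : 'rV[K]_#|fam_idx (fun a => d (head a)) (fun a => d (tail a))| =>
    fam_vec (fun a => E a *m fam_of_vec (y *m S) (tail a))).
  move=> c u v; rewrite -fam_vecZ -fam_vecD; apply: fam_vec_eq => a.
  by rewrite mulmxDl -scalemxAl !(fam_of_vecD, fam_of_vecZ) mulmxDr scalemxAr.
pose B : 'M[{poly K}]_#|fam_idx (fun a => d (head a)) (fun a => d (tail a))| :=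
  1%:M - 'X *: map_mx polyC N.
pose Y := map_mx polyC (fam_vec E) *m \adj B.
(* This is det B times 1 + h, which clears the denominators. It is the identity at t = 0, so the
   product of its determinants over the nodes is a nonzero polynomial. *)
pose g x : 'M[{poly K}]_(d x) :=
  (\det B)%:M + 'X *: fam_of_vec (Y *m map_mx polyC S) x.
have evB t : map_mx (horner_eval t) B = 1%:M - t *: N.
  by rewrite map_mxB map_mx1 map_mxZ /= map_horner_polyC /horner_eval hornerX.
pose y t := fam_vec E *m \adj (1%:M - t *: N).
have evg t x : map_mx (horner_eval t) (g x) =
    (\det (1%:M - t *: N))%:M + fam_of_vec (t *: y t *m S) x.
  rewrite map_mxD map_scalar_mx map_mxZ /= map_fam_of_vec -scalemxAl fam_of_vecZ.
  rewrite !map_mxM !map_horner_polyC map_mx_adj evB -det_map_mx evB.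
  by rewrite /horner_eval hornerX.
exists (\prod_x \det (g x)).
  apply/eqP => /(congr1 (horner_eval 0)).
  rewrite rmorph_prod /= raddf0 => /eqP; apply/negP; apply/prodf_neq0 => x _.
  rewrite -det_map_mx evg scale0r subr0 det1 scale0r mul0mx fam_of_vec0 addr0 det1.
  exact: oner_neq0.
move=> t; rewrite rootE -[_.[t]]/(horner_eval t _) rmorph_prod => /prodf_neq0 gt.
have gU x : map_mx (horner_eval t) (g x) \in unitmx.
  by rewrite unitmxE unitfE det_map_mx; apply: gt.
exists (fun x => map_mx (horner_eval t) (g x)).
exists (fun x => invmx (map_mx (horner_eval t) (g x))).
split=> [x|x|a]; rewrite ?mulmxV ?mulVmx //.
rewrite !evg; have yB : y t *m (1%:M - t *: N) = \det (1%:M - t *: N) *: fam_vec E.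
  by rewrite -mulmxA mul_adj_mx mul_mx_scalar.
move: (y t) (\det _) yB => yt c yB.
have : t *: yt = (t * c) *: fam_vec E + t *: (t *: yt *m N).
  by rewrite -scalerA -yB -scalerDr mulmxBr mulmx1 -scalemxAl -scalemxAr subrK.
rewrite -{1}[t *: yt]mulmx1 -SL mulmxA LE -NE -!fam_vecZ -fam_vecD.
move=> /fam_vec_inj/(_ a).
move: (fam_of_vec _) => h hE.
rewrite !mulmxDl !mulmxDr mul_scalar_mx !mul_mx_scalar -addrA; congr (_ + _).
move/eqP: hE; rewrite subr_eq => /eqP ->.
by rewrite -scalemxAl scalerA [c * t]mulrC addrC.
Qed.

(** In characteristic zero the natural numbers alone provide more values [inj u - w] than [p] has
    roots. *)
Lemma exists_nonroot (k K : fieldType) (inj : {rmorphism k -> K})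
    (p : {poly K}) w :
  [pchar k] =i pred0 -> p != 0 -> exists u, ~~ root p (inj u - w).
Proof.
move=> /pcharf0P char0 p0; apply: NNPP => noroot.
pose s := [seq inj i%:R - w | i <- seq.iota 0 (size p)].
have nat_inj : injective (fun i : nat => i%:R : k).
  move=> i j; wlog ij : i j / (i <= j)%N => [hw|].
    by case/orP: (leq_total i j) => h e; [|symmetry]; apply: hw.
  move/eqP; rewrite eq_sym -subr_eq0 -natrB // char0 subn_eq0 => ji.
  by apply/eqP; rewrite eqn_leq ij.
have uniq_s : uniq s.
  by rewrite map_inj_uniq ?iota_uniq // => i j /addIr/fmorph_inj; apply: nat_inj.
have root_s : all (root p) s.
  apply/allP => _ /mapP[i _ ->]; apply/negPn/negP => nr.
  by apply: noroot; exists i%:R.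
by have := max_poly_roots p0 root_s uniq_s; rewrite size_map size_iota ltnn.
Qed.

Lemma rep_iso_eq (K : fieldType) (Q : quiver) (d : dimvec Q) (V W : rep K d) :
  (forall a, V a = W a) -> rep_iso V W.
Proof.
move=> VW; exists (fun x => 1%:M), (fun x => 1%:M).
by split=> *; rewrite ?mulmx1 ?mul1mx.
Qed.

(** Coordinates are made constant one at a time: replacing a coordinate w by [inj u] is a
    deformation with parameter [inj u - w], and all but finitely many parameters stay within the
    isomorphism class. *)
Lemma rigid_constant (k K : fieldType) (inj : {rmorphism k -> K}) (Q : quiver)
    (d : dimvec Q) (W : rep K d) :
  [pchar k] =i pred0 -> ext_vanishes W W ->
  exists V : rep k d, rep_iso (fun a => map_mx inj (V a)) W.
Proof.
move=> char0 rigW.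
have coords (s : seq (rep_coord d)) : exists2 W' : rep K d, rep_iso W W' &
    forall c, c \in s ->
      exists u, W' (tag c) (tagged c).1 (tagged c).2 = inj u.
  elim: s => [|c s [W' iso coordW']]; first by exists W => //; apply: rep_iso_refl.
  pose E : rep K d := fun a => \matrix_(i, j)
    (Tagged (fun a => ('I_(d (head a)) * 'I_(d (tail a)))%type) (i, j) == c)%:R.
  have [p p0 pE] := rigid_deform E (ext_vanishes_iso iso rigW).
  have [u /pE isoE] :=
    exists_nonroot inj (W' (tag c) (tagged c).1 (tagged c).2) char0 p0.
  exists (fun a => W' a + (inj u - W' (tag c) (tagged c).1 (tagged c).2) *: E a).
    exact: rep_iso_trans iso isoE.
  move=> c'; rewrite inE !mxE; case: eqP => [->|/eqP ne] /=.
    by exists u; case: (c) => a [i j] /=; rewrite eqxx mulr1 addrC subrK.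
  move=> /coordW'[v ->]; exists v.
  case: c' ne => a [i j] /= /negPf ->.
  by rewrite mulr0 addr0.
have [W' iso coordW'] := coords (enum (rep_coord d)).
have /fin_all_exists[v vE] : forall c : rep_coord d, exists u,
    W' (tag c) (tagged c).1 (tagged c).2 = inj u.
  by move=> c; apply: coordW'; rewrite mem_enum.
exists (fun a => \matrix_(i, j)
  v (Tagged (fun a => ('I_(d (head a)) * 'I_(d (tail a)))%type) (i, j))).
apply: rep_iso_trans (rep_iso_sym iso); apply: rep_iso_eq => a.
by apply/matrixP=> i j; rewrite !mxE -vE.
Qed.

Lemma rep_constant (k K : fieldType) (inj : {rmorphism k -> K}) (Q : quiver)
    (d : dimvec Q) (W : rep K d) :
  [pchar k] =i pred0 -> tits_positive Q ->
  exists (e : dimvec Q) (V : rep k e), rep_iso (fun a => map_mx inj (V a)) W.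
Proof.
move=> char0 tits; have [n] := ubnP (total_dim d).
elim: n d W => // n IH d W; rewrite ltnS => dn.
have [d0|/not_all_ex_not d0] := classic (forall x, d x = 0%N).
  exists d, (fun a => 0); apply: rep_iso_eq => a.
  by apply/matrixP=> i; case: i => i lti; exfalso; rewrite d0 in lti.
have [indW|nindW] := classic (indecomposable W).
  have [//|V iso] := @rigid_constant _ _ inj _ _ W char0.
    exact: brick_rigid tits d0 (indecomposable_brick tits indW).
  by exists d, V.
have [d1 [d2 [W1 [W2 [iso d10 d20]]]]] := not_indecomposable d0 nindW.
have tdE : total_dim d = (total_dim d1 + total_dim d2)%N.
  by rewrite /total_dim -big_split; apply: eq_bigr => x _; rewrite (rep_iso_dim iso).
have [|e1 [V1 iso1]] := IH d1 W1.
  by rewrite (leq_trans _ dn) // tdE -addn1 leq_add2l total_dim_gt0.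
have [|e2 [V2 iso2]] := IH d2 W2.
  by rewrite (leq_trans _ dn) // tdE -add1n leq_add2r total_dim_gt0.
exists (fun x => (e1 x + e2 x)%N), (rep_sum V1 V2).
apply: rep_iso_trans (rep_iso_sym iso).
apply: rep_iso_trans (rep_iso_sum iso1 iso2); apply: rep_iso_eq => a.
by rewrite /rep_sum map_block_mx !map_mx0.
Qed.

(** Schur's lemma: subtracting an eigenvalue of [g] at one node leaves an endomorphism that is not
    invertible, hence zero at every node. *)
Lemma brick_end_scalar (k : closedFieldType) (Q : quiver) (d : dimvec Q)
    (V : rep k d) g :
  (exists x, d x <> 0%N) -> brick V -> is_hom V V g ->
  exists c, forall x, g x = c%:M.
Proof.
move=> [y /eqP dy] brV hg.
have [|c] := closed_rootP (char_poly (g y)) _.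
  by rewrite size_char_poly eqSS.
rewrite -eigenvalue_root_char => ev.
have [|h|u] := brV (fun x => g x - c%:M).
- by move=> a; rewrite mulmxBl mulmxBr hg mul_scalar_mx mul_mx_scalar.
- by exists c => x; apply/eqP; rewrite -subr_eq0 h.
- exfalso; move/eigenvalueP: ev => [v vg v0]; move: v0; apply/negP; rewrite negbK.
  rewrite -(mulmx_free_eq0 _ (B := g y - c%:M)) ?row_free_unit //.
  by rewrite mulmxBr vg mul_mx_scalar subrr.
Qed.

(** This is q(d) = dim Hom(V, V) - dim Ext(V, V) = 1 - 0. *)
Lemma rigid_brick_dim (k : closedFieldType) (Q : quiver) (d : dimvec Q)
    (V : rep k d) :
  (exists x, d x <> 0%N) -> brick V -> ext_vanishes V V ->
  (\sum_x d x * d x = (\sum_a d (head a) * d (tail a)).+1)%N.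
Proof.
move=> d0 brV; have [L LE] := hom_defect_mx V V.
move=> /(ext_vanishes_row_full LE)/eqP rkL.
pose I : 'rV[k]_#|fam_idx d d| := fam_vec (fun x => 1%:M).
have kerI : (kermx L == I)%MS.
  apply/andP; split; last first.
    apply/sub_kermxP; rewrite LE; apply/rowP=> j; rewrite mxE !fam_vecK.
    by rewrite mul1mx mulmx1 subrr !mxE.
  apply/row_subP => i; have /sub_kermxP := row_sub i (kermx L).
  move: (row _ _) => u uL.
  have [|c cE] := @brick_end_scalar k Q d V (fam_of_vec u) d0 brV.
    move=> a; apply/eqP; rewrite -subr_eq0; apply/eqP.
    by have := fam_vec_inj (etrans (esym (LE u)) (etrans uL (esym (fam_of_vecK 0)))) a;
      rewrite fam_of_vec0.
  apply/submxP; exists c%:M; rewrite mul_scalar_mx -fam_vecZ -[LHS]fam_of_vecK.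
  by apply: fam_vec_eq => x; rewrite cE scalemx1.
have I0 : I != 0.
  have [x dx] := d0; apply/eqP => I0.
  have /(congr1 mxrank) := fam_vec_inj (etrans I0 (esym (fam_of_vecK 0))) x.
  by rewrite fam_of_vec0 mxrank1 mxrank0.
have := mxrank_ker L; rewrite (eqmx_rank kerI) rank_rV I0 rkL => e1.
have := rank_leq_row L; rewrite rkL => le.
by rewrite -[LHS]card_fam_idx -card_fam_idx -(subnK le) -e1 add1n.
Qed.

(** * Positivity of the Tits form of a Dynkin quiver *)

Section TitsForm.
Import Order.TTheory Num.Theory.

(** Squares are completed from the free end 0 of an arm with m nodes, attached at node m. For a
    given value at node m the arm contributes at least - m / (2 (m + 1)) times its square, which
    explains the constant. *)
Lemma arm_form (f : nat -> rat) (m : nat) :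
  let S := \sum_(i < m) (f i ^+ 2 - f i * f i.+1)
           + m%:R / (2 * m.+1%:R) * f m ^+ 2 in
  0 <= S /\ (S = 0 -> f m = 0 -> forall i, (i <= m)%N -> f i = 0).
Proof.
elim: m => [|m [IH1 IH2]] /=.
  rewrite big_ord0 !mul0r addr0; split=> // _ f0 i.
  by rewrite leqn0 => /eqP ->.
set S := _ + _ in IH1 IH2 *.
have a0 : 0 < m.+1%:R :> rat by rewrite ltr0n.
have -> : \sum_(i < m.+1) (f i ^+ 2 - f i * f i.+1)
    + m.+1%:R / (2 * m.+2%:R) * f m.+1 ^+ 2
  = S + m.+2%:R / (2 * m.+1%:R) * (f m - m.+1%:R / m.+2%:R * f m.+1) ^+ 2.
  rewrite big_ord_recr /= /S; move: (\sum_(i < m) _) => s.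
  have -> : m.+2%:R = m.+1%:R + 1 :> rat by rewrite -[m.+2]addn1 natrD.
  have -> : m%:R = m.+1%:R - 1 :> rat by rewrite -[m.+1]addn1 natrD addrK.
  move: (m.+1%:R) a0 => a a0; field.
  by rewrite (gt_eqF a0) (gt_eqF (addr_gt0 a0 ltr01)).
have c0 : 0 < m.+2%:R / (2 * m.+1%:R) :> rat.
  by apply: divr_gt0; rewrite ?mulr_gt0 ?ltr0n.
split; first by rewrite addr_ge0 // mulr_ge0 ?sqr_ge0 // ltW.
move=> S0 fm1 i; rewrite leq_eqVlt => /orP[/eqP -> //|]; rewrite ltnS.
move: S0; rewrite fm1 mulr0 subr0 => S0.
have sq0 : m.+2%:R / (2 * m.+1%:R) * f m ^+ 2 = 0.
  have : 0 <= m.+2%:R / (2 * m.+1%:R) * f m ^+ 2.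
    by rewrite mulr_ge0 ?sqr_ge0 // ltW.
  by move: S0 IH1; move: (_ * _) => t; move: (S) => u; lra.
move: S0; rewrite sq0 addr0 => S0; apply: IH2 => //.
by move/eqP: sq0; rewrite mulf_eq0 gt_eqF //= sqrf_eq0 => /eqP.
Qed.

Lemma nonneg_sum4 (y z u w : rat) : 0 <= y -> 0 <= z -> 0 <= u -> 0 <= w ->
  0 <= y + z + u + w /\
  (y + z + u + w = 0 -> [/\ y = 0, z = 0, u = 0 & w = 0]).
Proof. by move=> *; split=> [|?]; [lra | split; lra]. Qed.

(** An arm with m nodes uses up m / (2 (m + 1)) of the square at the branch node [b], and the arm
    [x] uses up 1/4. The hypothesis says that the three shares add up to less than 1; for p = b + 1
    and q = r + 1 it is the classical 1/p + 1/q + 1/2 > 1. *)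
Lemma star_form (f : nat -> rat) (b r : nat) (x : rat) :
  (2 * (b * r.+1 + r * b.+1) < 3 * (b.+1 * r.+1))%N ->
  let q := \sum_(i < (b + r).+1) f i ^+ 2 - \sum_(i < b + r) f i * f i.+1
           + (x ^+ 2 - f b * x) in
  0 <= q /\ (q = 0 -> x = 0 /\ forall i, (i <= b + r)%N -> f i = 0).
Proof.
(* The second long arm, read from its own free end. *)
move=> br q; pose g i := f (b + r - i)%N.
have [S1 Z1] := arm_form f b; have [S2 Z2] := arm_form g r.
set s1 := _ + _ in S1 Z1; set s2 := _ + _ in S2 Z2.
have gr : g r = f b by rewrite /g addnK.
pose ka : rat := 3 / 4 - b%:R / (2 * b.+1%:R) - r%:R / (2 * r.+1%:R).
have ka0 : 0 < ka.
  move: br; rewrite -(ltr_nat rat) !natrM !natrD !natrM => br.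
  have b0 : 0 < b.+1%:R :> rat by rewrite ltr0n.
  have r0 : 0 < r.+1%:R :> rat by rewrite ltr0n.
  have -> : ka = (3 * (b.+1%:R * r.+1%:R) - 2 * (b%:R * r.+1%:R + r%:R * b.+1%:R))
                  / (4 * (b.+1%:R * r.+1%:R)).
    rewrite /ka; move: (b.+1%:R) (r.+1%:R) b0 r0 => B1 R1 b0 r0; field.
    by rewrite (gt_eqF b0) (gt_eqF r0).
  by apply: divr_gt0; rewrite ?subr_gt0 // !mulr_gt0.
have sumE : \sum_(i < (b + r).+1) f i ^+ 2 - \sum_(i < b + r) f i * f i.+1 =
    \sum_(i < b) (f i ^+ 2 - f i * f i.+1) +
    \sum_(i < r) (g i ^+ 2 - g i * g i.+1) + f b ^+ 2.
  rewrite !sumrB -(big_mkord xpredT (fun i => f i ^+ 2)).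
  rewrite -(big_mkord xpredT (fun i => f i * f i.+1)).
  rewrite (big_cat_nat (n := b)) //=; last by rewrite ltnW // ltnS leq_addr.
  rewrite [X in _ - X](big_cat_nat (n := b)) ?leq_addr //=.
  rewrite !big_mkord [\sum_(b <= i < (b + r).+1) _]big_ltn ?ltnS ?leq_addr //.
  have -> : \sum_(b.+1 <= i < (b + r).+1) f i ^+ 2 = \sum_(i < r) g i ^+ 2.
    rewrite -[b.+1]add0n big_addn subSS addKn big_mkord.
    rewrite (reindex_inj rev_ord_inj) /=; apply: eq_bigr => i _.
    by rewrite /g; congr (f _ ^+ 2); move: (ltn_ord i); lia.
  have -> : \sum_(b <= i < b + r) f i * f i.+1 = \sum_(i < r) g i * g i.+1.
    rewrite -[X in \sum_(X <= _ < _) _]add0n big_addn addKn big_mkord.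
    rewrite (reindex_inj rev_ord_inj) /=; apply: eq_bigr => i _.
    by rewrite /g mulrC; congr (f _ * f _); move: (ltn_ord i); lia.
  by ring.
have qE : q = s1 + s2 + (x - f b / 2) ^+ 2 + ka * f b ^+ 2.
  rewrite /q sumE /s1 /s2 /ka gr.
  move: (\sum_(i < b) _) (\sum_(i < r) _) => u w.
  have b0 : b.+1%:R != 0 :> rat by rewrite pnatr_eq0.
  have r0 : r.+1%:R != 0 :> rat by rewrite pnatr_eq0.
  by move: (b.+1%:R) (r.+1%:R) b0 r0 => B1 R1 b0 r0; field; rewrite b0 r0.
have t3 : 0 <= (x - f b / 2) ^+ 2 by rewrite sqr_ge0.
have t4 : 0 <= ka * f b ^+ 2 := mulr_ge0 (ltW ka0) (sqr_ge0 _).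
have [q_ge0 q_eq0] := nonneg_sum4 S1 S2 t3 t4.
rewrite qE; split=> // /q_eq0[e1 e2 e3] {q_ge0 q_eq0 qE}.
move/eqP; rewrite mulf_eq0 (gt_eqF ka0) /= sqrf_eq0 => /eqP fb0.
move: e3; rewrite fb0 mul0r subr0 => /eqP; rewrite sqrf_eq0 => /eqP x0.
split=> // i ibr; have [ib|bi] := leqP i b; first exact: Z1.
have -> : f i = g (b + r - i)%N by rewrite /g subKn.
by apply: Z2; rewrite ?gr //; lia.
Qed.

(** The star with arms of b, p - b and 1 nodes, numbered as types D and E are in [dynkin_edge]. *)
Definition star_edge (b p i j : nat) : bool :=
  ((j == i.+1) && (j < p.+1)%N) || ((i == b) && (j == p.+1)).

Lemma sum_pick n m (P : bool) (F : nat -> nat) :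
  (\sum_(j < n) ((j == m :> nat) && P) * F j = if (m < n) && P then F m else 0)%N.
Proof.
case: P; rewrite ?andbT ?andbF; last by rewrite big1 // => j _; rewrite andbF.
case: ifP => mn; last first.
  rewrite big1 // => j _; case: eqP => // jm.
  by rewrite -jm ltn_ord in mn.
rewrite (bigD1 (Ordinal mn)) //= eqxx mul1n big1 ?addn0 // => j.
by rewrite -val_eqE /= => /negPf ->.
Qed.

Lemma sum_star_edge (b p : nat) (e : nat -> nat) : (b <= p)%N ->
  (\sum_(i < p.+2) \sum_(j < p.+2) star_edge b p i j * (e i * e j) =
   \sum_(i < p) e i * e i.+1 + e b * e p.+1)%N.
Proof.
move=> bp.
have inner (i : 'I_p.+2) : (\sum_(j < p.+2) star_edge b p i j * (e i * e j) =
    (if (i < p)%N then e i * e i.+1 else 0) + (i == b :> nat) * (e i * e p.+1))%N.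
  have E (j : 'I_p.+2) : (star_edge b p i j * (e i * e j) =
      ((j == i.+1 :> nat) && (i < p)%N) * (e i * e j) +
      ((j == p.+1 :> nat) && (i == b :> nat)) * (e i * e j))%N.
    rewrite -mulnDl; congr (_ * _)%N; rewrite /star_edge.
    by move: (ltn_ord i) (ltn_ord j); lia.
  rewrite (eq_bigr _ (fun j _ => E j)) big_split /=.
  rewrite (sum_pick _ _ _ (fun j => e i * e j)%N) (sum_pick _ _ _ (fun j => e i * e j)%N).
  congr (_ + _)%N; last by rewrite ltnSn; case: eqP; rewrite ?mul1n.
  by rewrite (_ : (i.+1 < p.+2) && (i < p) = (i < p))%N //; lia.
rewrite (eq_bigr _ (fun i _ => inner i)) big_split /=; congr (_ + _)%N.
  rewrite 2!big_ord_recr /= ltnn ltnNge leqnSn !addn0.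
  by apply: eq_bigr => i _; rewrite ltn_ord.
have := sum_pick p.+2 b true (fun i => e i * e p.+1)%N.
rewrite ltnS (leq_trans bp (leqnSn _)) /= => <-.
by apply: eq_bigr => i _; rewrite andbT.
Qed.

Lemma star_positive (b r : nat) (e : nat -> nat) :
  (2 * (b * r.+1 + r * b.+1) < 3 * (b.+1 * r.+1))%N ->
  (exists2 i, i < (b + r).+2 & e i != 0)%N ->
  (\sum_(i < (b + r).+2) \sum_(j < (b + r).+2)
      star_edge b (b + r) i j * (e i * e j) < \sum_(i < (b + r).+2) e i ^ 2)%N.
Proof.
move=> br [i0 i0n ei0]; rewrite sum_star_edge ?leq_addr // big_ord_recr /=.
rewrite -(ltr_nat rat) !natrD !natr_sum natrX natrM.
have [q0 qZ] := star_form (fun i => (e i)%:R) (e (b + r).+1)%:R br.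
set q := (X in 0 <= X) in q0 qZ.
have qE : \sum_(i < (b + r).+1) (e i ^ 2)%:R + (e (b + r).+1)%:R ^+ 2 -
    (\sum_(i < b + r) (e i * e i.+1)%:R + (e b)%:R * (e (b + r).+1)%:R) = q.
  rewrite opprD addrACA /q.
  by congr (_ - _ + _); apply: eq_bigr => i _; rewrite ?natrX ?natrM.
rewrite lt_def -subr_ge0 -subr_eq0 qE q0 andbT.
apply: contra ei0 => /eqP /qZ[x0 f0].
move: i0n; rewrite ltnS leq_eqVlt => /orP[/eqP -> |].
  by rewrite -(eqr_nat rat) x0.
by rewrite ltnS => /f0 /eqP; rewrite pnatr_eq0.
Qed.

Lemma dynkin_positive (T : dynkin_type) (e : nat -> nat) :
  let n := dynkin_rank T in (exists2 i, i < n & e i != 0)%N ->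
  (\sum_(i < n) \sum_(j < n) dynkin_edge T i j * (e i * e j) <
   \sum_(i < n) e i ^ 2)%N.
Proof.
case: T => n hn /= ex.
(* A path is a star with branch node at its end and r = 0, enlarged by one node on which the vector
   is set to zero. *)
- case: n hn ex => // n _ [i0 i0n ei0].
  pose e' i := if (i <= n)%N then e i else 0%N.
  have e'n : e' n.+1 = 0%N by rewrite /e' ltnn.
  have e'E (i : 'I_n.+1) : e' i = e i by rewrite /e' -ltnS ltn_ord.
  have cond : (2 * (n * 1 + 0 * n.+1) < 3 * (n.+1 * 1))%N by lia.
  have := @star_positive n 0 e' cond; rewrite addn0.
  have ex' : exists2 i, (i < n.+2)%N & e' i != 0%N.
    by exists i0; rewrite 1?ltnW // /e' -ltnS i0n.
  move=> /(_ ex').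
  rewrite [X in (_ < X)%N]big_ord_recr /= e'n addn0 big_ord_recr /=.
  rewrite [X in (_ + X < _)%N]big1 ?addn0 => [|j _]; last by rewrite e'n mul0n muln0.
  congr (_ < _)%N; last by apply: eq_bigr => i _; rewrite e'E.
  apply: eq_bigr => i _; rewrite big_ord_recr /= e'n !muln0 addn0.
  apply: eq_bigr => j _; rewrite !e'E /star_edge; congr (_ * _)%N.
  by move: (ltn_ord i) (ltn_ord j); lia.
- have cond : (2 * ((n - 3) * 2 + 1 * (n - 3).+1) < 3 * ((n - 3).+1 * 2))%N by lia.
  have nE : (n - 3 + 1).+2 = n by lia.
  have := @star_positive (n - 3) 1 e cond; rewrite nE => /(_ ex).
  congr (_ < _)%N; apply: eq_bigr => i _; apply: eq_bigr => j _.
  by congr (_ * _)%N; rewrite /star_edge; lia.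
(* The arms have 2, n - 4 and 1 nodes, and the inequality amounts to n < 9. *)
- have cond : (2 * (2 * (n - 4).+1 + (n - 4) * 3) < 3 * (3 * (n - 4).+1))%N by lia.
  have nE : (2 + (n - 4)).+2 = n by lia.
  have := @star_positive 2 (n - 4) e cond; rewrite nE => /(_ ex).
  congr (_ < _)%N; apply: eq_bigr => i _; apply: eq_bigr => j _.
  by congr (_ * _)%N; rewrite /star_edge; lia.
Qed.

Lemma dynkin_edge_asym (T : dynkin_type) (i j : nat) :
  (dynkin_adj T i j = dynkin_edge T i j + dynkin_edge T j i :> nat)%N.
Proof. by case: T => n hn; rewrite /dynkin_adj /=; lia. Qed.

Lemma dynkin_edge_irrefl (T : dynkin_type) (i : nat) : dynkin_edge T i i = false.
Proof. by case: T => n hn /=; lia. Qed.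

(** Adjacency counts each edge in both orders, whence the factor 2. The weak bound serves the
    components of a quiver on which the vector vanishes. *)
Lemma dynkin_adj_bound (T : dynkin_type) (e : nat -> nat) :
  let n := dynkin_rank T in
  let s := (\sum_(i < n) \sum_(j < n) dynkin_adj T i j * (e i * e j))%N in
  let t := (2 * \sum_(i < n) e i ^ 2)%N in
  (s <= t)%N /\ ((exists2 i, i < n & e i != 0)%N -> (s < t)%N).
Proof.
move=> n s t.
have -> : s = (2 * \sum_(i < n) \sum_(j < n) dynkin_edge T i j * (e i * e j))%N.
  rewrite mul2n -addnn [X in (_ + X)%N]exchange_big -big_split /=.
  apply: eq_bigr => i _; rewrite -big_split; apply: eq_bigr => j _ /=.
  by rewrite dynkin_edge_asym mulnDl [(e j * e i)%N]mulnC.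
rewrite leq_pmul2l // ltn_pmul2l //; split; last exact: dynkin_positive.
have [ex|nex] := classic (exists2 i, (i < n)%N & e i != 0%N).
  exact/ltnW/dynkin_positive.
rewrite big1 // => i _; rewrite big1 // => j _.
have -> : e i = 0%N.
  by apply/eqP; apply: contraPT nex => ei; apply; exists i.
by rewrite mul0n muln0.
Qed.

Lemma sum_pick_pair (I : finType) (s t : I) (F : I -> I -> nat) :
  (\sum_x \sum_y ((s == x) && (t == y)) * F x y = F s t)%N.
Proof.
rewrite (bigD1 s) //= (bigD1 t) //= !eqxx mul1n !big1 ?addn0 // => x xs.
  by rewrite big1 // => y _; rewrite eq_sym (negPf xs).
by rewrite [t == x]eq_sym (negPf xs) andbF.
Qed.

Lemma dynkin_quiver_tits_positive (Q : quiver) :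
  dynkin_quiver Q -> tits_positive Q.
Proof.
case=> m [T [f [[f' fK f'K] adjE]]] d [x0 dx0].
pose inc x y (a : arrow Q) :=
  ((tail a == x) && (head a == y)) || ((tail a == y) && (head a == x)).
have multE x y : edge_mult x y = (\sum_a inc x y a)%N.
  rewrite /edge_mult -sum1_card big_mkcond /=; apply: eq_bigr => a _.
  by rewrite inE; case: ifP; rewrite /inc => ->.
have noloop (a : arrow Q) : tail a != head a.
  apply/eqP => h; have := adjE (tail a) (tail a).
  rewrite /dynkin_union_adj eqxx /= dynkin_edge_asym multE (bigD1 a) //=.
  by rewrite /inc -h !eqxx dynkin_edge_irrefl.
(* As its ends are distinct, each arrow is counted exactly once for each order of them. *)
have sumE : (\sum_x \sum_y edge_mult x y * (d x * d y)
             = 2 * \sum_a d (tail a) * d (head a))%N.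
  under eq_bigr do under eq_bigr do rewrite multE big_distrl.
  under eq_bigr do rewrite exchange_big; rewrite exchange_big big_distrr /=.
  apply: eq_bigr => a _.
  rewrite mul2n -addnn -(sum_pick_pair (tail a) (head a) (fun x y => d x * d y)%N).
  rewrite [X in (_ + X)%N]exchange_big -big_split /=; apply: eq_bigr => x _.
  rewrite -big_split; apply: eq_bigr => y _ /=.
  rewrite [(d y * d x)%N]mulnC -mulnDl; congr (_ * _)%N; rewrite /inc.
  have := noloop a; case: (tail a =P x) => [->|_] /=; last by rewrite add0n.
  case: (head a =P x) => [->|_]; first by rewrite eqxx.
  by rewrite andbF orbF addn0.
(* The vector on component c, extended by zero to all natural numbers as the bounds for a single
   diagram expect. *)
pose e c i := if insub i is Some j then
  d (f' (Tagged (fun c => 'I_(dynkin_rank (T c))) (j : 'I_(dynkin_rank (T c))))) else 0%N.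
have eE c (i : 'I_(dynkin_rank (T c))) :
    d (f' (Tagged (fun c => 'I_(dynkin_rank (T c))) i)) = e c i.
  by rewrite /e valK.
have f'_bij : bijective f' by exists f.
have tag_sum (G : dynkin_union_node T -> nat) :
    (\sum_x G (f x) = \sum_c \sum_(i < dynkin_rank (T c))
      G (Tagged (fun c => 'I_(dynkin_rank (T c))) i))%N.
  rewrite (reindex f') /=; last exact: onW_bij.
  rewrite (sig_big_dep xpredT (fun _ _ => true)
    (fun c i => G (Tagged (fun c => 'I_(dynkin_rank (T c))) i))) /=.
  by apply: eq_bigr => -[c i] _; rewrite f'K.
have adj_sum : (\sum_x \sum_y edge_mult x y * (d x * d y) =
    \sum_c \sum_(i < dynkin_rank (T c)) \sum_(j < dynkin_rank (T c))
       dynkin_adj (T c) i j * (e c i * e c j))%N.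
  pose G u v := (dynkin_union_adj u v * (d (f' u) * d (f' v)))%N.
  have -> : (\sum_x \sum_y edge_mult x y * (d x * d y)
             = \sum_x \sum_y G (f x) (f y))%N.
    by apply: eq_bigr => x _; apply: eq_bigr => y _; rewrite /G !fK -adjE.
  rewrite (tag_sum (fun u => \sum_y G u (f y))%N); apply: eq_bigr => c _.
  apply: eq_bigr => i _; rewrite (tag_sum (G _)) (bigD1 c) //=.
  rewrite [X in (_ + X)%N]big1 ?addn0 => [|c' cc'].
    by apply: eq_bigr => j _; rewrite /G !eE /dynkin_union_adj eqxx.
  by rewrite big1 // => j _; rewrite /G /dynkin_union_adj /= eq_sym (negPf cc').
have sq_sum : (\sum_x d x ^ 2 = \sum_c \sum_(i < dynkin_rank (T c)) e c i ^ 2)%N.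
  rewrite -[LHS](eq_bigr _ (fun x _ => congr1 (fun y => d y ^ 2)%N (fK x))).
  rewrite (tag_sum (fun u => d (f' u) ^ 2)%N).
  by apply: eq_bigr => c _; apply: eq_bigr => i _; rewrite eE.
have main : (\sum_x \sum_y edge_mult x y * (d x * d y) < 2 * \sum_x d x ^ 2)%N.
  rewrite adj_sum sq_sum big_distrr /=.
  pose c0 := tag (f x0).
  rewrite (bigD1 c0) //= [X in (_ < X)%N](bigD1 c0) //= -addSn.
  apply: leq_add; last by apply: leq_sum => c _; apply: (dynkin_adj_bound _ _).1.
  apply: (dynkin_adj_bound _ _).2; exists (tagged (f x0)); first exact: ltn_ord.
  rewrite -eE (_ : Tagged _ _ = f x0) ?fK; first by apply/eqP.
  by rewrite /c0; case: (f x0).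
by move: main; rewrite sumE ltn_pmul2l.
Qed.

End TitsForm.

(** * The infinitesimal action *)

(** The bracket [psi, W], that is, the tangent vector at [W] given by the infinitesimal action of
    psi. The ring is arbitrary because the universal representation, its translates and their
    specializations are all compared. *)
Definition defect (S : comNzRingType) (Q : quiver) (d : dimvec Q)
    (psi : forall x, 'M[S]_(d x))
    (W : forall a, 'M[S]_(d (head a), d (tail a))) a :=
  psi (head a) *m W a - W a *m psi (tail a).

(** The matrix of dtilde evaluated at an arbitrary point [W]; the columns are the tangent vectors of
    the basis elements. *)
Definition defect_mx (k S : comNzRingType) (inj : k -> S) (Q : quiver)
    (d : dimvec Q) (b : 'I_(rep_dim d) -> forall x, 'M[k]_(d x))
    (W : forall a, 'M[S]_(d (head a), d (tail a))) : 'M[S]_(rep_dim d) :=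
  \matrix_(j, i) fam_vec (defect (fun x => map_mx inj (b i x)) W) 0 j.

Lemma defect_linearr (S : comNzRingType) (Q : quiver) (d : dimvec Q) psi
    (W W' : forall a, 'M[S]_(d (head a), d (tail a))) c a :
  defect psi (fun a => W a + c *: W' a) a = defect psi W a + c *: defect psi W' a.
Proof.
by rewrite /defect mulmxDl mulmxDr -scalemxAl -scalemxAr scalerBr opprD addrACA.
Qed.

Lemma defect_linearl (S : comNzRingType) (Q : quiver) (d : dimvec Q) psi psi'
    (W : forall a, 'M[S]_(d (head a), d (tail a))) c a :
  defect (fun x => psi x + c *: psi' x) W a = defect psi W a + c *: defect psi' W a.
Proof.
by rewrite /defect mulmxDl mulmxDr -scalemxAl -scalemxAr scalerBr opprD addrACA.
Qed.

Lemma defect_scalar (S : comNzRingType) (Q : quiver) (d : dimvec Q) psi s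
    (W : forall a, 'M[S]_(d (head a), d (tail a))) a :
  defect (fun x => psi x + s%:M) W a = defect psi W a.
Proof.
by rewrite /defect mulmxDl mulmxDr mul_scalar_mx mul_mx_scalar opprD addrACA
  subrr addr0.
Qed.

Lemma defect_sum (S : comNzRingType) (Q : quiver) (d : dimvec Q)
    (J : finType) (psi : J -> forall x, 'M[S]_(d x))
    (W : forall a, 'M[S]_(d (head a), d (tail a))) (c : J -> S) a :
  defect (fun x => \sum_i c i *: psi i x) W a = \sum_i c i *: defect (psi i) W a.
Proof.
rewrite /defect mulmx_suml mulmx_sumr -sumrB; apply: eq_bigr => i _.
by rewrite -scalemxAl -scalemxAr scalerBr.
Qed.

Lemma map_defect (S S' : comNzRingType) (f : {rmorphism S -> S'}) (Q : quiver)
    (d : dimvec Q) psi (W : forall a, 'M[S]_(d (head a), d (tail a))) a :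
  map_mx f (defect psi W a) =
  defect (fun x => map_mx f (psi x)) (fun a => map_mx f (W a)) a.
Proof. by rewrite map_mxB !map_mxM. Qed.

Lemma defect_mxE (k S : comNzRingType) (inj : k -> S) (Q : quiver)
    (d : dimvec Q) b (W : forall a, 'M[S]_(d (head a), d (tail a))) j i :
  defect_mx inj b W j i = defect (fun x => map_mx inj (b i x)) W
    (tag (enum_val j)) (tagged (enum_val j)).1 (tagged (enum_val j)).2.
Proof. by rewrite mxE mxE. Qed.

Lemma map_defect_mx (k S S' : comNzRingType) (inj : k -> S)
    (f : {rmorphism S -> S'}) (Q : quiver) (d : dimvec Q) b W :
  map_mx f (@defect_mx k S inj Q d b W) =
  defect_mx (f \o inj) b (fun a => map_mx f (W a)).
Proof.
apply/matrixP=> j i; rewrite mxE !defect_mxE.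
move: (tag _) (tagged _) => a [u v] /=.
have /matrixP/(_ u v) := map_defect f (fun x => map_mx inj (b i x)) W a.
rewrite mxE => ->; have E x : map_mx f (map_mx inj (b i x)) = map_mx (f \o inj) (b i x).
  by rewrite map_mx_comp.
by rewrite /defect !E.
Qed.

Lemma defect_mx_linear (k S : comNzRingType) (inj : k -> S) (Q : quiver)
    (d : dimvec Q) b (W W' : forall a, 'M[S]_(d (head a), d (tail a))) c :
  defect_mx inj b (fun a => W a + c *: W' a) =
  defect_mx inj b W + c *: defect_mx inj b W'.
Proof.
apply/matrixP=> j i; rewrite defect_mxE defect_linearr.
rewrite [RHS]mxE [X in _ = _ + X]mxE !defect_mxE [LHS]mxE.
by congr (_ + _); apply: mxE.
Qed.

Lemma defect_mx_col (k S : comNzRingType) (inj : k -> S) (Q : quiver)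
    (d : dimvec Q) b (W : forall a, 'M[S]_(d (head a), d (tail a))) c :
  defect_mx inj b W *m c = (fam_vec (defect
    (fun x => \sum_i c i 0 *: map_mx inj (b i x)) W))^T.
Proof.
apply/colP=> j; rewrite [LHS]mxE [RHS]mxE [RHS]mxE defect_sum summxE.
apply: eq_bigr => i _; rewrite [RHS]mxE mulrC; congr (_ * _).
exact: defect_mxE.
Qed.

(** Base change: only the elementary matrices have to be expanded, and they are defined over [k]. *)
Lemma pgl_basis_span (k K : fieldType) (inj : {rmorphism k -> K}) (Q : quiver)
    (d : dimvec Q) n (b : 'I_n -> gl k d) (psi : forall x, 'M[K]_(d x)) :
  pgl_basis b -> exists (c : 'I_n -> K) s,
    forall x, psi x = \sum_i c i *: map_mx inj (b i x) + s%:M.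
Proof.
case=> spanb _; pose I := fam_idx d d.
pose E (y : I) x : 'M[k]_(d x) := \matrix_(i, j)
  (Tagged (fun x => ('I_(d x) * 'I_(d x))%type) (i, j) == y)%:R.
have /fin_all_exists[C CE] : forall y : I, exists C : ('I_n -> k) * k,
    forall x, E y x = \sum_i C.1 i *: b i x + C.2%:M.
  by move=> y; have [c [s cs]] := spanb (E y); exists (c, s).
pose w (y : I) := psi (tag y) (tagged y).1 (tagged y).2.
exists (fun i => \sum_y w y * inj ((C y).1 i)), (\sum_y w y * inj (C y).2) => x.
have -> : psi x = \sum_y w y *: map_mx inj (E y x).
  apply/matrixP=> i j; rewrite summxE.
  rewrite (bigD1 (Tagged (fun x => ('I_(d x) * 'I_(d x))%type) (i, j) : I)) //=.
  rewrite !mxE eqxx rmorph1 mulr1 big1 ?addr0 // => y ne.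
  by rewrite !mxE eq_sym (negPf ne) rmorph0 mulr0.
have sumE y : w y *: map_mx inj (E y x) =
    \sum_i (w y * inj ((C y).1 i)) *: map_mx inj (b i x) + (w y * inj (C y).2)%:M.
  rewrite CE map_mxD map_mx_sum map_scalar_mx scalerDr scaler_sumr scale_scalar_mx.
  by congr (_ + _); apply: eq_bigr => i _; rewrite map_mxZ scalerA.
under eq_bigr do rewrite sumE; rewrite big_split /= exchange_big /= -raddf_sum.
by congr (_ + _); apply: eq_bigr => i _; rewrite scaler_suml.
Qed.

(** The coordinates [c] of psi modulo scalars are chosen before [W'], so that the same vector can be
    used at two different representations. *)
Lemma defect_mx_onto (k K : fieldType) (inj : {rmorphism k -> K}) (Q : quiver)
    (d : dimvec Q) (b : 'I_(rep_dim d) -> gl k d)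
    (psi : forall x, 'M[K]_(d x)) :
  pgl_basis b -> exists c, forall W' : rep K d,
    defect_mx inj b W' *m c = (fam_vec (defect psi W'))^T /\
    (c = 0 -> forall a, defect psi W' a = 0).
Proof.
move=> pglb; have [c [s cs]] := pgl_basis_span inj psi pglb.
exists (\col_i c i) => W'; split=> [|c0 a].
  rewrite defect_mx_col; congr (_^T); apply: fam_vec_eq => a.
  have E x : \sum_i (\col_i c i) i 0 *: map_mx inj (b i x) + s%:M = psi x.
    by rewrite cs; congr (_ + _); apply: eq_bigr => i _; rewrite mxE.
  by rewrite -[LHS](defect_scalar _ s) /defect !E.
rewrite /defect !cs !big1 ?add0r ?mul_scalar_mx ?mul_mx_scalar ?subrr // => i _;
  by move/colP/(_ i): c0; rewrite !mxE => ->; rewrite scale0r.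
Qed.

(* Replacing a column of [A0 + T A1] by its product with [c], which is
   [(T - z) A1 c], exhibits [T - z] as a factor of the determinant, with
   a cofactor nonzero at [z]. *)
Lemma det_pencil_simple_root (K : fieldType) n (A0 A1 : 'M[K]_n) z (c w : 'cV_n) :
  (A0 + z *: A1) *m c = 0 ->
  (forall y : 'cV_n, exists u t, y = (A0 + z *: A1) *m u + t *: w) ->
  ~ (exists u, A1 *m c = (A0 + z *: A1) *m u) ->
  (\det (map_mx polyC A0 + 'X *: map_mx polyC A1))^`().[z] != 0.
Proof.
set A := A0 + z *: A1; set B := _ + _ *: _ => Ac span notin.
have /matrix0Pn[i0 [j0]] : c != 0.
  by apply/eqP => c0; apply: notin; exists 0; rewrite c0 !mulmx0.
rewrite [j0]ord1 => {j0} ci0.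
pose e : 'M[{poly K}]_n := \matrix_(i, j) if j == i0 then (c i 0)%:P else (i == j)%:R.
pose D : 'M[{poly K}]_n := \matrix_(i, j) 
  if (i == j) then if j == i0 then 'X - z%:P else 1 else 0.
pose C : 'M[{poly K}]_n := \matrix_(i, j) if j == i0 then ((A1 *m c) i 0)%:P else B i j.
have dete : \det e = (c i0 0)%:P.
  rewrite (expand_det_row e i0) (bigD1 i0) //= big1 ?addr0 => [|j ji0]; last first.
    by rewrite !mxE (negPf ji0) eq_sym (negPf ji0) mul0r.
  rewrite mxE eqxx; suff -> : cofactor e i0 i0 = 1 by rewrite mulr1.
  rewrite /cofactor addnn -signr_odd odd_double expr0 mul1r.
  suff -> : row' i0 (col' i0 e) = 1%:M by rewrite det1.
  by apply/matrixP=> i j; rewrite !mxE eq_sym (negPf (neq_lift _ _)) (inj_eq lift_inj).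
have detD : \det D = 'X - z%:P.
  have -> : D = diag_mx (\row_j if j == i0 then 'X - z%:P else 1).
    by apply/matrixP=> i j; rewrite !mxE; case: eqP => [->|_]; rewrite ?mulr1n ?mulr0n.
  rewrite det_diag (bigD1 i0) //= mxE eqxx big1 ?mulr1 // => j /negPf ji0.
  by rewrite mxE ji0.
have BeCD : B *m e = C *m D.
  apply/matrixP=> i j; rewrite [RHS]mxE (bigD1 j) //= big1 ?addr0; last first.
    by move=> l /negPf lj; rewrite [X in _ * X]mxE lj mulr0.
  rewrite [X in _ * X]mxE eqxx [C _ _]mxE; case: ifP => [/eqP ji0|ji0]; last first.
    rewrite mulr1 [LHS]mxE (bigD1 j) //= big1 ?addr0.
      by rewrite [X in _ * X]mxE ji0 eqxx mulr1.
    by move=> l /negPf lj; rewrite [X in _ * X]mxE ji0 lj mulr0.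
  have -> : (B *m e) i j = (B *m map_mx polyC c) i 0.
    rewrite [LHS]mxE [RHS]mxE; apply: eq_bigr => l _.
    by rewrite [e _ _]mxE ji0 eqxx [map_mx _ _ _ _]mxE.
  rewrite mulmxDl -scalemxAl -!map_mxM /=.
  have -> : A0 *m c = - z *: (A1 *m c).
    by apply/eqP; rewrite scaleNr -addr_eq0 scalemxAl -mulmxDl Ac.
  rewrite !mxE; move: (\sum_j1 _) => y.
  by rewrite polyCM polyCN mulrBr mulrC [X in _ + X]mulrC mulrN addrC.
have main : (c i0 0)%:P * \det B = ('X - z%:P) * \det C.
  by rewrite -dete -detD mulrC -det_mulmx BeCD det_mulmx mulrC.
have evB : map_mx (horner_eval z) B = A.
  by apply/matrixP=> i j; rewrite !mxE /horner_eval !hornerE.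
(* At z the matrix C is surjective. Its image contains that of A0 + z A1, because subtracting a
   multiple of the kernel vector c clears the coordinate i0. It also contains A1 c, which lies
   outside the latter image and spans the quotient, itself spanned by w. *)
have detC : (\det C).[z] != 0.
  rewrite -[_.[z]]/(horner_eval z _) -det_map_mx -unitfE -unitmxE.
  set Cz := map_mx _ C.
  have CzE (u : 'cV_n) : u i0 0 = 0 -> Cz *m u = A *m u.
    move=> ui0; apply/colP=> i; rewrite !mxE; apply: eq_bigr => j _.
    have [->|/negPf ji0] := eqVneq j i0; first by rewrite ui0 !mulr0.
    by rewrite -evB [Cz _ _]mxE [C _ _]mxE ji0 [in RHS]mxE.
  have Czi0 : Cz *m delta_mx i0 0 = A1 *m c.
    rewrite -colE; apply/colP=> i; rewrite mxE [Cz _ _]mxE [C _ _]mxE eqxx.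
    exact: hornerC.
  have imA (u : 'cV_n) : exists u' : 'cV_n, A *m u = Cz *m u'.
    exists (u - (u i0 0 / c i0 0) *: c); rewrite CzE.
      by rewrite mulmxBr -scalemxAr Ac scaler0 subr0.
    by rewrite !mxE divfK ?subrr.
  have onto (y : 'cV_n) : exists u : 'cV_n, y = Cz *m u.
    have [u1 [t1 yE]] := span y; have [u2 [t2 wE]] := span (A1 *m c).
    have t20 : t2 != 0.
      by apply/eqP => t20; apply: notin; exists u2; rewrite {1}wE t20 scale0r addr0.
    have [v1 v1E] := imA u1; have [v2 v2E] := imA u2.
    exists (v1 + (t1 / t2) *: (delta_mx i0 0 - v2)).
    rewrite mulmxDr -scalemxAr mulmxBr Czi0 wE -v2E [A *m u2 + _]addrC addrK scalerA divfK //.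
    by rewrite -v1E -yE.
  rewrite -unitmx_tr -row_full_unit -sub1mx; apply/row_subP => i.
  have [u uE] := onto (row i 1%:M)^T.
  by apply/submxP; exists u^T; rewrite -trmx_mul -uE trmxK.
have /(congr1 (fun p => p^`().[z])) := main.
rewrite !derivM !derivC derivB derivX derivC subr0 !hornerE subrr ?mul0r ?add0r ?addr0.
move=> e0; apply/eqP => e1; move: detC; rewrite -e0.
by rewrite e1 mulr0 eqxx.
Qed.

Lemma defect_mx_rigid_unit (k K : fieldType) (inj : {rmorphism k -> K})
    (Q : quiver) (d : dimvec Q) (b : 'I_(rep_dim d) -> gl k d) (W : rep K d) :
  pgl_basis b -> ext_vanishes W W -> \det (defect_mx inj b W) != 0.
Proof.
move=> pglb rigW; rewrite -unitfE -unitmxE -unitmx_tr -row_full_unit -sub1mx.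
apply/row_subP => i; have [psi psiE] := rigW (fam_of_vec (row i 1%:M)).
have [c /(_ W)[cE _]] := defect_mx_onto inj psi pglb.
apply/submxP; exists c^T; rewrite -trmx_mul cE trmxK -[LHS]fam_of_vecK.
by apply: fam_vec_eq => a; rewrite -psiE.
Qed.

(** By the Jacobi identity, bracketing with an endomorphism of [W] preserves the tangent space of
    the orbit of [W]. *)
Lemma defect_comm (S : comNzRingType) (Q : quiver) (d : dimvec Q) psi phi
    (W : forall a, 'M[S]_(d (head a), d (tail a))) :
  (forall a, defect psi W a = 0) ->
  forall a, defect psi (defect phi W) a =
    defect (fun x => psi x *m phi x - phi x *m psi x) W a.
Proof.
move=> h a; have {}h : psi (head a) *m W a = W a *m psi (tail a).
  by apply/eqP; rewrite -subr_eq0; apply/eqP/h.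
rewrite /defect !(mulmxBl, mulmxBr) !mulmxA h -!mulmxA h !mulmxA.
by rewrite !opprD addrACA.
Qed.

Lemma sum_sqrD (I : finType) (f g : I -> nat) :
  (\sum_x (f x + g x) * (f x + g x) =
   \sum_x f x * f x + \sum_x g x * g x + 2 * \sum_x f x * g x)%N.
Proof.
rewrite big_distrr -!big_split /=; apply: eq_bigr => x _.
by rewrite -[LHS]/((f x + g x) ^ 2)%N sqrnD.
Qed.

(** The class of v spans the normal space Ext(W, W) of the orbit. If [psi, v] were tangent,
    bracketing with psi would act as zero on Ext(W, W); but it acts as 1 on Ext(W2, W1) and as -1 on
    Ext(W1, W2), so both would vanish. *)
Lemma split_tangent (K : fieldType) (Q : quiver) (d : dimvec Q) (W v : rep K d) :
  tits_positive Q ->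
  (\sum_x d x * d x <= (\sum_a d (head a) * d (tail a)).+1)%N ->
  (exists x, d x <> 0%N) -> ~ indecomposable W ->
  (forall xi : rep K d, exists psi t, forall a, xi a = defect psi W a + t *: v a) ->
  exists psi, (forall a, defect psi W a = 0) /\
    ~ (exists phi, forall a, defect psi v a = defect phi W a).
Proof.
move=> tits dimd d0 nindW span.
have [d1 [d2 [W1 [W2 [iso d10 d20]]]]] := not_indecomposable d0 nindW.
have dE := rep_iso_dim iso; have [g [g' [gK g'K hg]]] := iso.
pose J x : 'M[K]_(d1 x + d2 x) := block_mx 1%:M 0 0 0.
have hg' a : W a *m g' (tail a) = g' (head a) *m rep_sum W1 W2 a.
  rewrite -[LHS]mul1mx -g'K -!mulmxA (mulmxA (g _) (W a)) hg -!mulmxA.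
  by rewrite gK mulmx1.
exists (fun x => g' x *m J x *m g x).
have psiW a : defect (fun x => g' x *m J x *m g x) W a = 0.
  apply/eqP; rewrite subr_eq0; apply/eqP.
  rewrite !mulmxA hg' -!mulmxA hg; congr (_ *m _).
  rewrite !mulmxA; congr (_ *m _).
  by rewrite /rep_sum /J !mulmx_block !(mul0mx, mulmx0, mul1mx, mulmx1, addr0).
split=> // -[phi0 phi0E].
have eigen_im e (eta : forall a, 'M[K]_(d1 (head a) + d2 (head a), d1 (tail a) + d2 (tail a))) :
    e != 0 -> (forall a, J (head a) *m eta a - eta a *m J (tail a) = e *: eta a) ->
    exists th : forall x, 'M[K]_(d1 x + d2 x), forall a,
      th (head a) *m rep_sum W1 W2 a - rep_sum W1 W2 a *m th (tail a) = eta a.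
  move=> e0 etaE.
  have [phi [t E]] := span (fun a => g' (head a) *m eta a *m g (tail a)).
  pose psi x := g' x *m J x *m g x.
  pose th x := (psi x *m phi x - phi x *m psi x) + t *: phi0 x.
  have thE a : defect th W a = e *: (g' (head a) *m eta a *m g (tail a)).
    rewrite /th defect_linearl -defect_comm // -phi0E.
    rewrite -[X in X + _]/(psi (head a) *m defect phi W a - _) -defect_linearr.
    rewrite /defect -!E /psi !mulmxA -(mulmxA _ (g _) (g' _)) gK mulmx1.
    rewrite -!mulmxA (mulmxA (g _) (g' _)) gK mul1mx -mulmxBr !mulmxA -mulmxBl.
    by rewrite etaE -scalemxAl -scalemxAr mulmxA.
  exists (fun x => e^-1 *: (g x *m th x *m g' x)) => a.
  rewrite -scalemxAl -scalemxAr -scalerBr -!mulmxA -hg' !mulmxA -hg.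
  rewrite -!(mulmxA (g _)) -mulmxBr -mulmxBl !mulmxA.
  rewrite -(mulmxA (g _)) -/(defect th W a) thE -scalemxAl -scalemxAr scalerA mulVf //.
  by rewrite scale1r !mulmxA gK mul1mx -mulmxA gK mulmx1.
have ext12 : ext_vanishes W1 W2.
  move=> xi; have [||th thE] := eigen_im (-1) (fun a => block_mx 0 0 (xi a) 0).
  - by rewrite oppr_eq0 oner_neq0.
  - move=> a; rewrite /J !mulmx_block !(mul0mx, mulmx0, mul1mx, mulmx1, addr0).
    by rewrite opp_block_mx add_block_mx scale_block_mx !scaler0 !subr0 ?oppr0 !add0r scaleN1r.
  exists (fun x => dlsubmx (th x)) => a; move: (thE a).
  rewrite -(submxK (th (head a))) -(submxK (th (tail a))) /rep_sum !mulmx_block.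
  rewrite opp_block_mx add_block_mx => /eq_block_mx[_ _ + _].
  by rewrite !(mul0mx, mulmx0, addr0, add0r) block_mxKdl block_mxKdl.
have ext21 : ext_vanishes W2 W1.
  move=> xi; have [||th thE] := eigen_im 1 (fun a => block_mx 0 (xi a) 0 0).
  - exact: oner_neq0.
  - move=> a; rewrite /J !mulmx_block !(mul0mx, mulmx0, mul1mx, mulmx1, addr0).
    by rewrite opp_block_mx add_block_mx scale1r !subr0 ?oppr0.
  exists (fun x => ursubmx (th x)) => a; move: (thE a).
  rewrite -(submxK (th (head a))) -(submxK (th (tail a))) /rep_sum !mulmx_block.
  rewrite opp_block_mx add_block_mx => /eq_block_mx[_ + _ _].
  by rewrite !(mul0mx, mulmx0, addr0, add0r) block_mxKur block_mxKur.
have := ext_vanishes_euler ext12; have := ext_vanishes_euler ext21.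
have := tits d1 d10; have := tits d2 d20.
have sqE (f : dimvec Q) : (\sum_x f x ^ 2 = \sum_x f x * f x)%N.
  by apply: eq_bigr => x _; rewrite mulnn.
rewrite !sqE => t1 t2 e1 e2; move: dimd; rewrite leqNgt => /negP[].
under [X in (_ < X)%N]eq_bigr do rewrite dE; rewrite sum_sqrD.
have -> : (\sum_a d (head a) * d (tail a) = \sum_a d1 (tail a) * d1 (head a)
   + \sum_a d2 (tail a) * d2 (head a) + (\sum_a d1 (tail a) * d2 (head a)
   + \sum_a d2 (tail a) * d1 (head a)))%N.
  rewrite -!big_split /=; apply: eq_bigr => a _; rewrite !dE mulnDl !mulnDr.
  rewrite [X in (_ + X)%N]addnC addnACA [X in (_ + X)%N]addnC.
  by congr ((_ + _) + (_ + _))%N; apply: mulnC.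
have e3 : (\sum_x d2 x * d1 x = \sum_x d1 x * d2 x)%N.
  by apply: eq_bigr => x _; rewrite mulnC.
rewrite -!addSn; apply: leq_add; first by rewrite addSnnS leq_add.
by rewrite mulSn mul1n leq_add // -e3.
Qed.

Lemma discriminant_tangent (k K : fieldType) (inj : {rmorphism k -> K})
    (Q : quiver) (d : dimvec Q) (b : 'I_(rep_dim d) -> gl k d) (W v : rep K d) :
  pgl_basis b -> tits_positive Q ->
  (\sum_x d x * d x <= (\sum_a d (head a) * d (tail a)).+1)%N ->
  (exists x, d x <> 0%N) ->
  (forall xi : rep K d, exists psi t, forall a, xi a = defect psi W a + t *: v a) ->
  \det (defect_mx inj b W) = 0 ->
  exists2 c : 'cV_(rep_dim d), defect_mx inj b W *m c = 0 &
    ~ exists u, defect_mx inj b v *m c = defect_mx inj b W *m u.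
Proof.
move=> pglb tits dimd d0 span det0.
have [|psi [psiW notin]] := split_tangent tits dimd d0 _ span.
  move=> indW; have /negP[] := defect_mx_rigid_unit inj pglb
    (brick_rigid tits d0 (indecomposable_brick tits indW)).
  by rewrite det0.
have [c cE] := defect_mx_onto inj psi pglb; exists c.
  rewrite (cE W).1; apply/colP=> j; rewrite mxE mxE psiW.
  by rewrite !mxE.
case=> u; rewrite (cE v).1 defect_mx_col => /trmx_inj uE.
apply: notin; exists (fun x => \sum_i u i 0 *: map_mx inj (b i x)) => a.
exact: fam_vec_inj uE a.
Qed.

(** * The generic point of the discriminant *)

Lemma fraction_clear (R : idomainType) (x : {fraction R}) :
  exists n d : R, d != 0 /\ x * tofrac d = tofrac n.
Proof.
elim/quotW: x => r; exists (\n_r), (\d_r); split; first exact: denom_ratioP.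
unlock tofrac; rewrite -[LHS]FracField.pi_mul; apply/eqmodP => /=.
have d0 : \d_r != 0 := denom_ratioP r.
by rewrite FracField.equivfE /FracField.mulf
  !(numer_Ratio, denom_Ratio) ?mulr1 ?oner_neq0 // mulrC.
Qed.

(** * Extending derivations to an algebraic point, and clearing denominators there *)

Section EvalDerivation.
Variables (R : idomainType) (K : fieldType) (tau : {rmorphism R -> K}) (z : K).

Definition eval_poly (q : {poly R}) : K := (map_poly tau q).[z].

Lemma eval_polyD p q : eval_poly (p + q) = eval_poly p + eval_poly q.
Proof. by rewrite /eval_poly rmorphD hornerD. Qed.

Lemma eval_polyM p q : eval_poly (p * q) = eval_poly p * eval_poly q.
Proof. by rewrite /eval_poly rmorphM hornerM. Qed.

Lemma eval_polyB p q : eval_poly (p - q) = eval_poly p - eval_poly q.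
Proof. by rewrite /eval_poly rmorphB hornerD hornerN. Qed.

Lemma eval_polyC c : eval_poly c%:P = tau c.
Proof. by rewrite /eval_poly map_polyC hornerC. Qed.

Lemma eval_polyX : eval_poly 'X = z.
Proof. by rewrite /eval_poly map_polyX hornerX. Qed.

Lemma eval_poly1 : eval_poly 1 = 1.
Proof. by rewrite eval_polyC rmorph1. Qed.

Lemma eval_poly0 : eval_poly 0 = 0.
Proof. by rewrite eval_polyC rmorph0. Qed.

Fact eval_poly_is_zmod_morphism : zmod_morphism eval_poly.
Proof. exact: eval_polyB. Qed.
Fact eval_poly_is_monoid_morphism : monoid_morphism eval_poly.
Proof. by split; [exact: eval_poly1 | exact: eval_polyM]. Qed.
HB.instance Definition _ :=
  GRing.isZmodMorphism.Build {poly R} K eval_poly eval_poly_is_zmod_morphism.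
HB.instance Definition _ :=
  GRing.isMonoidMorphism.Build {poly R} K eval_poly eval_poly_is_monoid_morphism.

Hypothesis tau_inj : injective tau.
Hypothesis K_char0 : [pchar K] =i pred0.
Hypothesis z_alg : exists2 q : {poly R}, q != 0 & eval_poly q = 0.

(* [D] is the derivation of [R[T]] extending [del] along evaluation at [z];
   its value at ['X] is forced by the algebraic equation of [z]. *)
Lemma eval_derivation (del : R -> R) :
  (forall a b, del (a + b) = del a + del b) ->
  (forall a b, del (a * b) = del a * b + a * del b) ->
  exists D : {poly R} -> K,
    [/\ forall p q, D (p + q) = D p + D q,
        forall p q, D (p * q) = D p * eval_poly q + eval_poly p * D q,
        forall r, D r%:P = tau (del r)
      & forall q, eval_poly q = 0 -> D q = 0].
Proof.
move=> delD delM.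
have del0 : del 0 = 0 by apply: (addrI (del 0)); rewrite -delD !addr0.
pose dl r := tau (del r).
have dl0 : dl 0 = 0 by rewrite /dl del0 rmorph0.
pose e q := (map_poly dl q).[z].
have eD p q : e (p + q) = e p + e q.
  rewrite -hornerD; congr _.[z]; apply/polyP=> i.
  by rewrite coefD !coef_map_id0 // coefD /dl delD rmorphD.
have dlM a b : dl (a * b) = dl a * tau b + tau a * dl b.
  by rewrite /dl delM rmorphD !rmorphM.
have dl_sum n (F : 'I_n -> R) : dl (\sum_i F i) = \sum_i dl (F i).
  by apply: (big_morph dl) => // a b; rewrite /dl delD rmorphD.
have eM p q : e (p * q) = e p * eval_poly q + eval_poly p * e q.
  rewrite -!hornerM -hornerD; congr _.[z]; apply/polyP=> i.
  rewrite coefD !coefM coef_map_id0 // coefM dl_sum -big_split /=.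
  apply: eq_bigr => j _.
  by rewrite dlM ![(map_poly dl _)`_ _]coef_map_id0 // !coef_map.
(* A polynomial over R of least size vanishing at z plays the role of the minimal polynomial; in
   characteristic zero its derivative does not vanish at z. *)
have [_ [f [f0 evf <-]] minf] : exists2 s,
    (exists f : {poly R}, [/\ f != 0, eval_poly f = 0 & size f = s]) &
    forall m, (exists f : {poly R}, [/\ f != 0, eval_poly f = 0 & size f = m]) -> (s <= m)%N.
  by have [q q0 evq] := z_alg; apply: ex_minimal; exists (size q), q.
have {}minf (q : {poly R}) : (size q < size f)%N -> eval_poly q = 0 -> q = 0.
  move=> lt evq; apply/eqP; apply: contraLR lt => q0; rewrite -leqNgt.
  by apply: minf; exists q.
have f'0 : f^`() != 0.
  have : (1 < size f)%N.
    rewrite ltnNge; apply/negP => /size1_polyC fC; move: evf f0.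
    rewrite fC eval_polyC => /eqP; rewrite -(rmorph0 tau) (inj_eq tau_inj).
    by move=> /eqP ->; rewrite eqxx.
  case sE : (size f) => [|[|s]] // _; apply/eqP => /(congr1 (coefp s)).
  rewrite /= coef_deriv coef0 => /(congr1 tau)/eqP.
  rewrite rmorphMn rmorph0 -mulr_natr mulf_eq0 ((pcharf0P K).1 K_char0) orbF.
  rewrite -(rmorph0 tau) (inj_eq tau_inj); apply/negP.
  by have := lead_coef_eq0 f; rewrite lead_coefE sE /= => ->.
have evf'0 : eval_poly f^`() != 0.
  apply: contra f'0 => /eqP h; apply/eqP; apply: minf h.
  exact: lt_size_deriv.
pose u := - (e f / eval_poly f^`()).
pose D q := e q + u * eval_poly q^`().
have DM p q : D (p * q) = D p * eval_poly q + eval_poly p * D q.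
  rewrite /D eM derivM eval_polyD !eval_polyM !mulrDl !mulrDr addrACA.
  by rewrite !mulrA [eval_poly p * u]mulrC.
have DC r : D r%:P = tau (del r).
  rewrite /D derivC eval_poly0 mulr0 addr0 /e.
  have -> : map_poly dl r%:P = (dl r)%:P.
    by apply/polyP=> i; rewrite coef_map_id0 // !coefC; case: eqP.
  by rewrite hornerC.
exists D; split=> // [p q|q evq].
  by rewrite /D eD derivD eval_polyD mulrDr addrACA.
have Df : D f = 0 by rewrite /D /u mulNr divfK // subrr.
(* R is not a field, so q is first multiplied by a power c of the leading coefficient of f. The
   remainder vanishes at z and is zero by minimality; applying D then gives tau(c) D(q) = 0. *)
have dE := Pdiv.Idomain.divp_eq q f.
set c := (lead_coef f ^+ _) in dE.
have c0 : c != 0 by rewrite expf_neq0 // lead_coef_eq0.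
have r0 : (q %% f)%R = 0.
  apply: minf; first by rewrite ltn_modp.
  move/(congr1 eval_poly): dE; rewrite -mul_polyC eval_polyD !eval_polyM.
  by rewrite evq evf !mulr0 add0r.
move/(congr1 D): dE; rewrite r0 addr0 -mul_polyC !DM evq evf Df !mulr0 !add0r.
rewrite eval_polyC => /eqP; rewrite mulf_eq0 -(rmorph0 tau) (inj_eq tau_inj) (negPf c0).
by rewrite rmorph0 => /eqP.
Qed.

End EvalDerivation.

Lemma exists_irreducible_factor (F : fieldType) (p : {poly F}) :
  (1 < size p)%N -> exists2 f, irreducible_poly f & f %| p.
Proof.
move=> sp; have [_ [f [sf fp <-]] minf] : exists2 s,
    (exists f : {poly F}, [/\ (1 < size f)%N, f %| p & size f = s]) &
    forall m, (exists f : {poly F}, [/\ (1 < size f)%N, f %| p & size f = m]) -> (s <= m)%N.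
  by apply: ex_minimal; exists (size p), p.
exists f => //; split=> // q q1 qf; rewrite -dvdp_size_eqp //.
have f0 : f != 0 by rewrite -size_poly_gt0 ltnW.
have q0 : q != 0 by apply: contraNneq f0 => q0; rewrite q0 dvd0p in qf.
rewrite eqn_leq dvdp_leq //=; apply: minf; exists q; split=> //.
  by rewrite ltn_neqAle eq_sym q1 size_poly_gt0.
exact: dvdp_trans qf fp.
Qed.

Section FractionExtension.
Variables (R : idomainType) (L : fieldExtType {fraction R}) (z : L).

Definition frac_embed : {rmorphism R -> L} := in_alg L \o @tofrac R.

Lemma frac_embed_inj : injective frac_embed.
Proof.
move=> a b /(@fmorph_inj _ _ (in_alg L)) ab; apply/eqP.
by rewrite -tofrac_eq ab.
Qed.

Hypothesis z_gen : <<1; z>>%VS = fullv.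

(** Up to a nonzero factor from R, elements of L lift to R[T], where the extended derivations are
    defined. *)
Lemma clear_denominator (y : L) : exists r q,
  r != 0 /\ frac_embed r * y = eval_poly frac_embed z q.
Proof.
have /Fadjoin_poly_eq <- : y \in <<1; z>>%VS by rewrite z_gen memvf.
have /polyOver1P[p ->] := Fadjoin_polyOver 1 z y.
elim/poly_ind: p => [|p c [r [q [r0 e]]]].
  by exists 1, 0; rewrite oner_neq0 !rmorph0 horner0 mulr0.
have [n [d [d0 cd]]] := fraction_clear c.
exists (r * d), (d%:P * q * 'X + (r * n)%:P); split; first by rewrite mulf_neq0.
have -> : (map_poly (in_alg L) (p * 'X + c%:P)).[z]
    = (map_poly (in_alg L) p).[z] * z + in_alg L c.
  by rewrite rmorphD rmorphM /= map_polyX map_polyC hornerD hornerM hornerX hornerC.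
rewrite eval_polyD !eval_polyM !eval_polyC eval_polyX (rmorphM _ r d) (rmorphM _ r n).
rewrite mulrDr -e; congr (_ + _).
  by rewrite !mulrA; congr (_ * _ * _); rewrite mulrC.
by rewrite -mulrA; congr (_ * _); rewrite /= -cd mulr_algl scalerA mulrC.
Qed.

Lemma clear_denominators (I : finType) (y : I -> L) : exists r q,
  r != 0 /\ forall i, frac_embed r * y i = eval_poly frac_embed z (q i).
Proof.
have /fin_all_exists[w wE] : forall i, exists w : R * {poly R},
    w.1 != 0 /\ frac_embed w.1 * y i = eval_poly frac_embed z w.2.
  by move=> i; have [r [q rq]] := clear_denominator (y i); exists (r, q).
exists (\prod_i (w i).1), (fun i => (\prod_(j | j != i) (w j).1)%:P * (w i).2).
split=> [|i]; first by apply/prodf_neq0 => i _; case: (wE i).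
have -> : \prod_i (w i).1 = (\prod_(j | j != i) (w j).1) * (w i).1.
  by rewrite (bigD1 i) //= mulrC.
by rewrite eval_polyM eval_polyC -(wE i).2 mulrA (rmorphM frac_embed).
Qed.

End FractionExtension.

(** * Restriction of polynomials to lines in a fixed direction *)

Lemma mpoly_ring_ind n (R : comNzRingType) (P : {mpoly R[n]} -> Prop) :
  (forall c, P c%:MP) -> (forall i, P 'X_i) ->
  (forall p q, P p -> P q -> P (p + q)) ->
  (forall p q, P p -> P q -> P (p * q)) -> forall p, P p.
Proof.
move=> PC PX PD PM; elim/mpolyind => [|c m p _ _ Pp]; first by rewrite -mpolyC0.
apply: (PD _ _ _ Pp); rewrite -mul_mpolyC; apply: (PM _ _ (PC c)).
have P1 : P 1 by rewrite -mpolyC1.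
rewrite mpolyXE_id; elim/big_ind: _ => // i _.
by elim: (m i) => [|e IH]; rewrite ?expr0 ?exprS //; apply: PM.
Qed.

Lemma mderiv_var n (R : comNzRingType) (i j : 'I_n) :
  ('X_i : {mpoly R[n]})^`M(j) = (i == j)%:R.
Proof.
rewrite mderivX mnm1E; case: eqP => [->|_]; last by rewrite scale0r.
rewrite scale1r (_ : (U_(j) - U_(j))%MM = 0%MM) ?mpolyX0 //.
by apply/mnmP=> l; rewrite mnmBE subnn mnm0E.
Qed.

Definition const2 (n : nat) (k : fieldType) :
    {rmorphism k -> {poly {mpoly k[n]}}} := @polyC {mpoly k[n]} \o @mpolyC n k.
Arguments const2 : clear implicits.

(** The substitution p |-> p(x + T v), pinned down by its values on ring generators. *)
Definition translation (n : nat) (k : fieldType) (v : 'I_n -> k)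
    (tr : {mpoly k[n]} -> {poly {mpoly k[n]}}) :=
  (forall c, tr c%:MP = const2 n k c) /\
  (forall i, tr 'X_i = ('X_i)%:P + const2 n k (v i) * 'X).

Lemma translation_exists (n : nat) (k : fieldType) (v : 'I_n -> k) :
  exists tr : {rmorphism {mpoly k[n]} -> {poly {mpoly k[n]}}}, translation v tr.
Proof.
exists (mmap (const2 n k) (fun i => ('X_i)%:P + const2 n k (v i) * 'X)).
by split=> [c|i] /=; rewrite ?mmapC // mmapX mmap1U.
Qed.

Section Translation.
Variables (n : nat) (k : fieldType) (v : 'I_n -> k).
Variable translate : {rmorphism {mpoly k[n]} -> {poly {mpoly k[n]}}}.
Hypothesis tr : translation v translate.

Let translateC := tr.1.
Let translateX := tr.2.

Lemma translate_at0 p : (translate p).[0] = p.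
Proof.
elim/mpoly_ring_ind: p => [c|i|p q hp hq|p q hp hq].
- by rewrite translateC hornerC.
- by rewrite translateX hornerD hornerM hornerX hornerC mulr0 addr0.
- by rewrite (rmorphD translate) hornerD hp hq.
- by rewrite (rmorphM translate) hornerM hp hq.
Qed.

Lemma deriv_translate p :
  (translate p)^`() = \sum_i const2 n k (v i) * translate p^`M(i).
Proof.
elim/mpoly_ring_ind: p => [c|i|p q hp hq|p q hp hq].
- rewrite translateC derivC big1 // => i _.
  by rewrite mderivC (rmorph0 translate) mulr0.
- rewrite translateX derivD derivC add0r derivM derivC mul0r add0r derivX mulr1.
  rewrite (bigD1 i) //= mderiv_var eqxx (rmorph1 translate) mulr1.
  rewrite big1 ?addr0 // => j ji.
  by rewrite mderiv_var eq_sym (negPf ji) (rmorph0 translate) mulr0.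
- rewrite (rmorphD translate) derivD hp hq -big_split /=; apply: eq_bigr => i _.
  by rewrite mderivD (rmorphD translate) mulrDr.
- rewrite (rmorphM translate) derivM hp hq mulr_suml mulr_sumr -big_split /=.
  apply: eq_bigr => i _; rewrite mderivM (rmorphD translate) !(rmorphM translate) mulrDr.
  by congr (_ + _); [rewrite mulrA | rewrite mulrCA].
Qed.

End Translation.

Lemma derivationE n (k : fieldType) (S : comNzRingType)
    (phi : {rmorphism {mpoly k[n]} -> S}) (E : {mpoly k[n]} -> S) :
  (forall p q, E (p + q) = E p + E q) ->
  (forall p q, E (p * q) = E p * phi q + phi p * E q) ->
  (forall c, E c%:MP = 0) ->
  forall p, E p = \sum_i E 'X_i * phi p^`M(i).
Proof.
move=> ED EM EC; elim/mpoly_ring_ind => [c|i|p q hp hq|p q hp hq].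
- by rewrite EC big1 // => i _; rewrite mderivC (rmorph0 phi) mulr0.
- rewrite (bigD1 i) //= mderiv_var eqxx (rmorph1 phi) mulr1.
  rewrite big1 ?addr0 // => j ji.
  by rewrite mderiv_var eq_sym (negPf ji) (rmorph0 phi) mulr0.
- rewrite ED hp hq -big_split /=; apply: eq_bigr => i _.
  by rewrite mderivD (rmorphD phi) mulrDr.
- rewrite EM hp hq mulr_suml mulr_sumr -big_split /=.
  apply: eq_bigr => i _; rewrite mderivM (rmorphD phi) !(rmorphM phi) mulrDr.
  by congr (_ + _); [rewrite mulrA | rewrite mulrCA].
Qed.

(** A + T B factors as (T + A B^-1) B. *)
Lemma det_pencil_monic (R : comUnitRingType) n (A B : 'M[R]_n) :
  B \in unitmx ->
  \det (map_mx polyC A + 'X *: map_mx polyC B) =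
  char_poly (- (A *m invmx B)) * (\det B)%:P.
Proof.
move=> uB; rewrite /char_poly -det_map_mx -det_mulmx; congr (\det _).
have E : map_mx polyC (A *m invmx B) *m map_mx polyC B = map_mx polyC A.
  by rewrite -map_mxM mulmxKV.
by rewrite /char_poly_mx mulmxBl mul_scalar_mx map_mxN mulNmx opprK E addrC.
Qed.

Lemma eq_defect_mx (k S : comNzRingType) (inj inj' : k -> S) (Q : quiver)
    (d : dimvec Q) b (W W' : forall a, 'M[S]_(d (head a), d (tail a))) :
  inj =1 inj' -> (forall a, W a = W' a) ->
  defect_mx inj b W = defect_mx inj' b W'.
Proof.
move=> ij WW'; apply/matrixP=> j i; rewrite !defect_mxE /defect !WW'.
by rewrite !(eq_map_mx _ ij).
Qed.

Lemma dtilde_mxE (k : fieldType) (Q : quiver) (d : dimvec Q)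
    (b : 'I_(rep_dim d) -> gl k d) :
  dtilde_mx b = defect_mx (@mpolyC (rep_dim d) k) b (universal_rep k d).
Proof. by apply/matrixP=> j i; rewrite [LHS]mxE [RHS]defect_mxE. Qed.

Lemma translate_universal (k : fieldType) (Q : quiver) (d : dimvec Q)
    (v : rep k d) (tr : {rmorphism coord_ring k d -> {poly coord_ring k d}}) a :
  translation (fun l => fam_vec v 0 l) tr ->
  map_mx tr (universal_rep k d a) = map_mx polyC (universal_rep k d a)
    + 'X *: map_mx (const2 (rep_dim d) k) (v a).
Proof.
case=> _ trX; apply/matrixP=> i j; rewrite [LHS]mxE.
rewrite [universal_rep _ _ _ _ _]mxE trX [RHS]mxE; congr (_ + _).
  by rewrite [RHS]mxE [universal_rep _ _ _ _ _]mxE.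
rewrite [RHS]mxE [map_mx _ _ _ _]mxE mulrC; congr (_ * const2 _ _ _).
by rewrite mxE enum_rankK.
Qed.

(** The matrix depends linearly on the representation, so translating along v turns it into a linear
    pencil in T. *)
Lemma translate_dtilde_mx (k : fieldType) (Q : quiver) (d : dimvec Q)
    (b : 'I_(rep_dim d) -> gl k d) (v : rep k d)
    (tr : {rmorphism coord_ring k d -> {poly coord_ring k d}}) :
  translation (fun l => fam_vec v 0 l) tr ->
  map_mx tr (dtilde_mx b) = map_mx polyC (dtilde_mx b)
    + 'X *: map_mx polyC (map_mx (@mpolyC (rep_dim d) k) (defect_mx id b v)).
Proof.
move=> trv; rewrite dtilde_mxE -map_mx_comp !map_defect_mx.
rewrite (eq_defect_mx (inj' := const2 (rep_dim d) k) _ trv.1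
  (fun a => translate_universal a trv)).
by rewrite defect_mx_linear; congr (_ + _ *: _); apply: eq_defect_mx => // a; rewrite map_mx_comp.
Qed.

Lemma map_mx_deriv (R S : comNzRingType) (D ev : R -> S) m n p
    (A : 'M[R]_(m, n)) (B : 'M[R]_(n, p)) :
  (forall x y, D (x + y) = D x + D y) ->
  (forall x y, D (x * y) = D x * ev y + ev x * D y) ->
  map_mx D (A *m B) = map_mx D A *m map_mx ev B + map_mx ev A *m map_mx D B.
Proof.
move=> DD DM; have D0 : D 0 = 0 by apply: (addrI (D 0)); rewrite -DD !addr0.
apply/matrixP=> i j; rewrite !mxE (big_morph D DD D0) -big_split /=.
by apply: eq_bigr => l _; rewrite DM !mxE.
Qed.

Lemma mxE_add_scale (R : comNzRingType) m n (A B : 'M[R]_(m, n)) c i j :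
  (A + c *: B) i j = A i j + c * B i j.
Proof. by rewrite !mxE. Qed.

Section GenericPoint.
Variables (k : fieldType) (Q : quiver) (d : dimvec Q) (v : rep k d).
Let R := coord_ring k d.
Variables (L : fieldExtType {fraction R}) (z : L).
Variable tr : {rmorphism R -> {poly R}}.
Hypotheses (k_char0 : [pchar k] =i pred0) (tits : tits_positive Q).
Hypothesis z_gen : <<1; z>>%VS = fullv.
Hypothesis z_alg : exists2 q : {poly R}, q != 0 & eval_poly (frac_embed L) z q = 0.
Hypothesis trv : translation (fun l => fam_vec v 0 l) tr.

Let ev : {rmorphism {poly R} -> L} := eval_poly (frac_embed L) z.
Let inj : {rmorphism k -> L} := frac_embed L \o @mpolyC (rep_dim d) k.

Definition generic_point : rep L d :=
  fun a => map_mx ev (map_mx tr (universal_rep k d a)).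

Lemma pchar_ext : [pchar L] =i pred0.
Proof. by move=> p; rewrite (fmorph_pchar inj) k_char0. Qed.

(* The generic point is isomorphic, through [g], to a representation defined
   over [k].  Differentiating this isomorphism in the direction of the j-th
   coordinate shows that this direction is tangent to the orbit, up to
   a multiple of [v]. *)
Lemma coordinate_tangent j : exists psi (t : L), forall a,
  fam_of_vec (delta_mx 0 j) a = defect psi generic_point a + t *: map_mx inj (v a).
Proof.
have [e [V0 [g [g' [gK g'K hg]]]]] :=
  rep_constant inj generic_point k_char0 tits.
have [r [q [r0 rq]]] := clear_denominators z_gen
  (fun y : fam_idx d e => g (tag y) (tagged y).1 (tagged y).2).
(* A lift of r g to R[T], where it can be differentiated. *)
pose gt x : 'M[{poly R}]_(d x, e x) := \matrix_(i, j)
  q (Tagged (fun x => ('I_(d x) * 'I_(e x))%type) (i, j)).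
have ev_gt x : map_mx ev (gt x) = frac_embed L r *: g x.
  apply/matrixP=> i l; rewrite [LHS]mxE [gt _ _ _]mxE [RHS]mxE.
  exact: (esym (rq (Tagged (fun x => ('I_(d x) * 'I_(e x))%type) (i, l)))).
have [D [DD DM DC Dker]] := eval_derivation (@frac_embed_inj R L) pchar_ext z_alg
  (@mderivD _ _ j) (@mderivM _ _ j).
pose Mt a := map_mx tr (universal_rep k d a).
pose V0t a := map_mx (const2 (rep_dim d) k) (V0 a).
have D0 : D 0 = 0 by apply: (addrI (D 0)); rewrite -DD !addr0.
have DN x : D (- x) = - D x by apply/eqP; rewrite -addr_eq0 -DD addNr D0.
have DV0 a : map_mx D (V0t a) = 0.
  by apply/matrixP=> i l; rewrite !mxE /= DC mderivC rmorph0.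
have evV0 a : map_mx ev (V0t a) = map_mx inj (V0 a).
  by apply/matrixP=> i l; rewrite !mxE /= [LHS]eval_polyC.
have DMt a : map_mx D (Mt a) = fam_of_vec (delta_mx 0 j) a + D 'X *: map_mx inj (v a).
  rewrite /Mt (translate_universal a trv); apply/matrixP=> i l.
  rewrite [LHS]mxE !mxE_add_scale DD DM.
  rewrite [map_mx polyC _ _ _]mxE DC [universal_rep _ _ _ _ _]mxE.
  rewrite [map_mx (const2 _ _) _ _ _]mxE [X in _ + (_ + _ * X)]DC mderivC rmorph0.
  rewrite mulr0 addr0 mderiv_var; congr (_ + _).
    by rewrite [RHS]mxE mxE eqxx andTb; case: eqP; rewrite ?rmorph1 ?rmorph0.
  by congr (_ * _); rewrite [RHS]mxE; apply: eval_polyC.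
(* D is defined on R[T] but depends only on values at z, so relations that hold merely at z, such as
   the isomorphism with V0, may be differentiated. *)
have ker_mx m n (X Y : 'M[{poly R}]_(m, n)) :
    map_mx ev X = map_mx ev Y -> map_mx D X = map_mx D Y.
  move=> XY; apply/matrixP=> i l; rewrite [LHS]mxE [RHS]mxE.
  apply/eqP; rewrite -subr_eq0 -DN -DD; apply/eqP/Dker.
  rewrite eval_polyB; apply/eqP; rewrite subr_eq0; apply/eqP.
  by move/matrixP/(_ i l): XY; rewrite mxE [RHS]mxE.
have rel a : map_mx D (Mt a) *m (frac_embed L r *: g (tail a)) +
    generic_point a *m map_mx D (gt (tail a)) =
    map_mx D (gt (head a)) *m map_mx inj (V0 a).
  rewrite -ev_gt -[generic_point a]/(map_mx ev (Mt a)) -map_mx_deriv //.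
  rewrite -evV0 -[RHS]addr0 -(mulmx0 _ (map_mx ev (gt (head a)))) -(DV0 a).
  rewrite -map_mx_deriv //; apply: ker_mx.
  rewrite !map_mxM !ev_gt evV0 -scalemxAl -scalemxAr; congr (_ *: _).
  by rewrite (hg a).
pose c := frac_embed L r.
have c0 : c != 0.
  by rewrite -(rmorph0 (frac_embed L)) (inj_eq (@frac_embed_inj _ _)).
exists (fun x => c^-1 *: (map_mx D (gt x) *m g' x)), (- D 'X) => a.
have V0g' : map_mx inj (V0 a) *m g' (tail a) = g' (head a) *m generic_point a.
  rewrite -[LHS]mul1mx -g'K -!mulmxA; congr (_ *m _).
  by rewrite mulmxA hg -mulmxA gK mulmx1.
apply/eqP; rewrite scaleNr eq_sym subr_eq -DMt eq_sym; apply/eqP.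
rewrite /defect -scalemxAl -scalemxAr -scalerBr -mulmxA -V0g' !mulmxA -rel.
rewrite mulmxDl addrK -scalemxAr -scalemxAl scalerA mulVf // scale1r.
by rewrite -mulmxA gK mulmx1.
Qed.

Lemma generic_point_span (xi : rep L d) : exists psi t, forall a,
  xi a = defect psi generic_point a + t *: map_mx inj (v a).
Proof.
have /fin_all_exists[w wE] : forall j, exists w : (forall x, 'M[L]_(d x)) * L,
    forall a, fam_of_vec (delta_mx 0 j) a =
      defect w.1 generic_point a + w.2 *: map_mx inj (v a).
  by move=> j; have [psi [t E]] := coordinate_tangent j; exists (psi, t).
pose y := fam_vec xi.
exists (fun x => \sum_j y 0 j *: (w j).1 x), (\sum_j y 0 j * (w j).2) => a.
rewrite defect_sum scaler_suml -big_split /= -(fam_vecK xi a) -/y.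
rewrite {1}(row_sum_delta y) fam_of_vec_sum; apply: eq_bigr => j _.
by rewrite fam_of_vecZ wE scalerDr scalerA.
Qed.

End GenericPoint.

Lemma mulr_cancel_unit (S : comNzRingType) (s p a b : S) :
  a * b = 1 -> s * p = s * b * (p * a).
Proof. by move=> ab; rewrite mulrACA [b * a]mulrC ab mulr1. Qed.

Lemma mulr_sum_multiple (S : comNzRingType) (I : finType) (c g w : I -> S) h D :
  (forall j, h * g j = w j * D) ->
  h * (\sum_j c j * g j) = (\sum_j c j * w j) * D.
Proof.
move=> hg; rewrite mulr_sumr mulr_suml; apply: eq_bigr => j _.
by rewrite mulrCA hg mulrA.
Qed.

(** * Separability of the translated discriminant and its consequences *)

Section Separability.
Variables (k : fieldType) (Q : quiver) (d : dimvec Q) (v : rep k d).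
Let R := coord_ring k d.
Variable tr : {rmorphism R -> {poly R}}.
Variable b : 'I_(rep_dim d) -> gl k d.
Hypotheses (k_char0 : [pchar k] =i pred0) (tits : tits_positive Q).
Hypothesis dim_d :
  (\sum_x d x * d x <= (\sum_a d (head a) * d (tail a)).+1)%N.
Hypothesis d_neq0 : exists x, d x <> 0%N.
Hypothesis pglb : pgl_basis b.
Hypothesis v_unit : defect_mx id b v \in unitmx.
Hypothesis trv : translation (fun l => fam_vec v 0 l) tr.

Let Delta : R := \det (dtilde_mx b).

Lemma translate_det_monic : exists2 P : {poly R}, P \is monic &
  exists2 c, c != 0 & tr Delta = P * (const2 (rep_dim d) k c).
Proof.
pose B := map_mx (@mpolyC (rep_dim d) k) (defect_mx id b v).
have uB : B \in unitmx.
  by rewrite unitmxE det_map_mx rmorph_unit // -unitmxE.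
exists (char_poly (- (dtilde_mx b *m invmx B))); first exact: char_poly_monic.
exists (\det (defect_mx id b v)); first by rewrite -unitfE -unitmxE.
rewrite -(det_map_mx tr (dtilde_mx b)).
rewrite (translate_dtilde_mx b trv).
rewrite (det_pencil_monic (dtilde_mx b) uB); congr (_ * _).
by rewrite (_ : \det B = (\det (defect_mx id b v))%:MP) //; apply: det_map_mx.
Qed.

Lemma translate_det_neq0 : tr Delta != 0.
Proof.
have [P mP [c c0 ->]] := translate_det_monic.
apply: mulf_neq0; first exact: monic_neq0.
by rewrite -[const2 _ _ _]/((c%:MP)%:P) polyC_eq0 mpolyC_eq0.
Qed.

Let PF := map_poly (@tofrac R) (tr Delta).

Lemma discriminant_separable : coprimep PF PF^`().
Proof.
have PF0 : PF != 0.
  apply/eqP => PF0; have /eqP[] := translate_det_neq0; apply/polyP=> i.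
  apply/eqP; rewrite coef0 -tofrac_eq0.
  by rewrite -[tofrac _](coef_map (@tofrac R)) -/PF PF0 coef0.
apply/negPn/negP; rewrite coprimep_def => gcd1.
have [|f irr_f] := @exists_irreducible_factor _ (gcdp PF PF^`()).
  by rewrite ltn_neqAle eq_sym gcd1 size_poly_gt0 gcdp_eq0 negb_and PF0.
rewrite dvdp_gcd => /andP[fP fP'].
(* L is generated by a common root z of P and its derivative; generation by z is what allows
   denominators to be cleared. *)
have [L _ [z fz z_gen]] := irredp_FAdjoin irr_f.
pose tau := frac_embed L.
have rootL (q : {poly R}) : f %| map_poly (@tofrac R) q -> eval_poly tau z q = 0.
  move=> fq; rewrite /eval_poly (_ : map_poly tau q = map_poly (in_alg L) (map_poly (@tofrac R) q)).
    have /dvdpP[r ->] := fq; rewrite (rmorphM (map_poly (in_alg L))) /=.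
    by rewrite hornerM (rootP fz) mulr0.
  by apply/polyP=> i; rewrite !coef_map.
have evP := rootL _ fP.
have evP' : eval_poly tau z (tr Delta)^`() = 0.
  by apply: rootL; rewrite -deriv_map.
have z_alg : exists2 q : {poly R}, q != 0 & eval_poly tau z q = 0.
  by exists (tr Delta) => //; apply: translate_det_neq0.
pose inj : {rmorphism k -> L} := tau \o @mpolyC (rep_dim d) k.
pose ev : {rmorphism {poly R} -> L} := eval_poly tau z.
pose W := generic_point z tr.
pose w : rep L d := fun a => map_mx inj (v a).
have span := generic_point_span k_char0 tits z_gen z_alg trv.
have WE : defect_mx inj b W = map_mx ev (map_mx tr (dtilde_mx b)).
  rewrite dtilde_mxE !map_defect_mx; apply: eq_defect_mx => // c /=.
  by rewrite trv.1 [RHS]eval_polyC.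
have A1E : defect_mx inj b w = map_mx inj (defect_mx id b v).
  by rewrite map_defect_mx; apply: eq_defect_mx.
have pencil : defect_mx inj b W = map_mx tau (dtilde_mx b) + z *: defect_mx inj b w.
  rewrite WE (translate_dtilde_mx b trv) map_mxD map_mxZ A1E; congr (_ + _ *: _).
  - by apply/matrixP=> i j; rewrite !mxE [LHS]eval_polyC.
  - exact: eval_polyX.
  - by apply/matrixP=> i j; rewrite !mxE [LHS]eval_polyC.
have detW : \det (defect_mx inj b W) = 0.
  by rewrite WE !det_map_mx; apply: evP.
have [c Wc notin] := discriminant_tangent pglb tits dim_d d_neq0 span detW.
have := @det_pencil_simple_root L _ (map_mx tau (dtilde_mx b)) (defect_mx inj b w) z c
  (fam_vec w)^T; rewrite -pencil => /(_ Wc _ notin) /=.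
move=> simple; have /negP[] : ((map_poly tau (tr Delta))^`()).[z] != 0; last first.
  by apply/eqP; rewrite deriv_map; apply: evP'.
rewrite (_ : map_poly tau (tr Delta) = \det (map_mx polyC (map_mx tau (dtilde_mx b))
    + 'X *: map_mx polyC (defect_mx inj b w))).
  apply: simple => y; have [psi [t E]] := span (fam_of_vec y^T).
  have [u uE] := defect_mx_onto inj psi pglb; exists u, t.
  rewrite (uE W).1; apply: trmx_inj; rewrite linearD linearZ /= !trmxK.
  rewrite -fam_vecZ -fam_vecD -[LHS]fam_of_vecK.
  by apply: fam_vec_eq => a; rewrite E.
rewrite -(det_map_mx tr) (translate_dtilde_mx b trv).
rewrite -(det_map_mx (map_poly tau)) map_mxD map_mxZ A1E /= map_polyX.
by congr (\det (_ + _ *: _)); apply/matrixP=> i j; rewrite !mxE ?map_polyC.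
Qed.

(** P is monic up to a constant, so q can be divided by it inside R[T]. The remainder is divisible
    by P over the fraction field and of smaller size, hence zero. *)
Lemma dvd_translate_det (q : {poly R}) :
  PF %| map_poly (@tofrac R) q -> exists s, q = s * tr Delta.
Proof.
have [P mP [c c0 trE]] := translate_det_monic; pose i := @tofrac R.
have injP (p : {poly R}) : map_poly i p = 0 -> p = 0.
  move=> p0; apply/polyP=> l; apply/eqP; rewrite coef0 -tofrac_eq0.
  by rewrite -[tofrac _](coef_map i) p0 coef0.
have sizeP (p : {poly R}) : size (map_poly i p) = size p.
  by rewrite size_map_inj_poly ?rmorph0 // => x y /eqP; rewrite tofrac_eq => /eqP.
move=> dvd; have := Pdiv.IdomainMonic.divp_eq mP q.
set s := _ %/ _; set r := _ %% _ => qE.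
have r_lt : (size r < size P)%N by rewrite ltn_modp monic_neq0.
have r0 : r = 0.
  have : map_poly i P %| map_poly i r.
    have -> : r = q - s * P by rewrite qE addrC addKr.
    rewrite rmorphB (rmorphM (map_poly i)) dvdp_subr ?dvdp_mull //.
    by apply: dvdp_trans dvd; rewrite /PF trE rmorphM dvdp_mulr.
  move=> dvd_r; apply: injP; apply/eqP; apply: contraTT r_lt => r0.
  by rewrite -leqNgt -(sizeP r) -(sizeP P) dvdp_leq.
exists (s * const2 (rep_dim d) k c^-1); rewrite qE r0 addr0 trE.
by apply: mulr_cancel_unit; rewrite -(rmorphM (const2 _ _)) mulfV.
Qed.

Lemma in_principal_translate (p : R) s :
  tr p = s * tr Delta -> in_principal Delta p.
Proof.
move=> E; exists s.[0]; rewrite -(translate_at0 trv p) E hornerM.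
by rewrite (translate_at0 trv).
Qed.

Lemma discriminant_radical (p : R) e :
  in_principal Delta (p ^+ e) -> in_principal Delta p.
Proof.
case=> r pe; pose i := map_poly (@tofrac R).
have dvd_e : PF %| i (tr p) ^+ e.
  by rewrite -(rmorphXn i) -(rmorphXn tr) pe (rmorphM tr) (rmorphM i) dvdp_mulIr.
suff /dvd_translate_det[s] : PF %| i (tr p) by apply: in_principal_translate.
have sep := discriminant_separable.
(* Write PF = h g. By separability h is prime to g, hence to the translate of p; as h divides a
   power of that translate, it is a unit, and PF divides the translate itself. *)
set g := gcdp PF (i (tr p)).
have [h PFE] : exists h, PF = h * g by apply/dvdpP/dvdp_gcdl.
have cop_hg : coprimep h g.
  have /separable_polyP[+ _] : separable_poly PF by rewrite separable_poly.unlock.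
  by apply; rewrite -PFE.
have cop_hp : coprimep h (i (tr p)).
  apply/coprimepP=> u uh up; have /coprimepP := cop_hg; apply=> //.
  by rewrite dvdp_gcd up (dvdp_trans uh) // PFE dvdp_mulr.
have : h %| i (tr p) ^+ e by apply: dvdp_trans dvd_e; rewrite PFE dvdp_mulr.
rewrite -[_ ^+ e]mulr1 Gauss_dvdpr ?coprimep_expr // => h1.
by rewrite PFE -[i _]mul1r dvdp_mul ?dvdp_gcdr.
Qed.

(** By the chain rule P' is a combination of the translated partial derivatives of Delta. Hence P
    divides the translate of h times P', and P is prime to P'. *)
Lemma discriminant_dvd_grad (h : R) :
  (forall j, in_principal Delta (h * Delta^`M(j))) -> in_principal Delta h.
Proof.
move=> /fin_all_exists[w wE]; pose i := map_poly (@tofrac R).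
suff /dvd_translate_det[s] : PF %| i (tr h) by apply: in_principal_translate.
rewrite -(Gauss_dvdpl _ discriminant_separable) /PF deriv_map -(rmorphM i).
rewrite (deriv_translate trv).
rewrite (@mulr_sum_multiple _ _ _ _ (fun j => tr (w j)) _ (tr Delta)).
  by rewrite (rmorphM i) dvdp_mulIr.
by move=> j; rewrite -(rmorphM tr) wE (rmorphM tr).
Qed.

End Separability.

(** * Logarithmic vector fields *)

(** The Jacobi identity for the infinitesimal action. *)
Lemma defect_commutator (S : comNzRingType) (Q : quiver) (d : dimvec Q) psi phi
    (W : forall a, 'M[S]_(d (head a), d (tail a))) a :
  defect psi (defect phi W) a = defect phi (defect psi W) a +
    defect (fun x => psi x *m phi x - phi x *m psi x) W a.
Proof.
have zmod (V : zmodType) (p q r s t u : V) :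
    p - q - (r - s) = (t - r - (q - u)) + (p - t - (u - s)).
  rewrite !opprB [RHS]addrACA [t - r + _]addrC [u - q + _]addrC !subrKA.
  by rewrite [LHS]addrACA [RHS]addrACA [- q - r]addrC.
rewrite /defect !(mulmxBl, mulmxBr) !mulmxA; exact: zmod.
Qed.

Section Jacobi.
Variables (R : comNzRingType) (del : R -> R).
Hypothesis delD : forall x y, del (x + y) = del x + del y.
Hypothesis delM : forall x y, del (x * y) = del x * y + x * del y.

Let del0 : del 0 = 0.
Proof. by apply: (addrI (del 0)); rewrite -delD !addr0. Qed.

Let delN x : del (- x) = - del x.
Proof. by apply/eqP; rewrite -addr_eq0 -delD addNr del0. Qed.

Let del1 : del 1 = 0.
Proof.
by apply: (addrI (del 1)); rewrite addr0 -[in RHS](mulr1 1) delM mul1r mulr1.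
Qed.

Lemma derivation_prod (I : eqType) (r : seq I) (F : I -> R) : uniq r ->
  del (\prod_(i <- r) F i) =
  \sum_(i <- r) \prod_(j <- r) (if j == i then del (F j) else F j).
Proof.
elim: r => [|a r IH] /=; first by rewrite !big_nil del1.
case/andP=> ar ur; rewrite !big_cons delM IH // eqxx; congr (_ * _ + _).
  rewrite !big_seq; apply: eq_bigr => j jr; case: eqP => // ja.
  by rewrite -ja jr in ar.
rewrite mulr_sumr !big_seq; apply: eq_bigr => i ir.
by rewrite big_cons; case: eqP => // ai; rewrite ai ir in ar.
Qed.

(** Jacobi's formula, obtained by differentiating one row at a time and expanding along it. *)
Lemma derivation_det n (A : 'M[R]_n) :
  del (\det A) = \tr (map_mx del A *m \adj A).
Proof.
pose B i := \matrix_(j, l) (if j == i then del (A j l) else A j l).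
have -> : del (\det A) = \sum_i \det (B i).
  rewrite /determinant (big_morph del delD del0) exchange_big /=.
  apply: eq_bigr => s _.
  have -> x : del ((-1) ^+ perm.odd_perm s * x) = (-1) ^+ perm.odd_perm s * del x.
    by case: (perm.odd_perm s); rewrite ?expr1 ?expr0 ?mul1r // !mulN1r delN.
  rewrite -mulr_sumr derivation_prod ?index_enum_uniq //; congr (_ * _).
  by apply: eq_bigr => i _; apply: eq_bigr => j _; rewrite mxE.
apply: eq_bigr => i _; rewrite (expand_det_row _ i) mxE.
apply: eq_bigr => l _; rewrite !mxE eqxx; congr (_ * (_ * \det _)).
by apply/matrixP=> u w; rewrite !mxE eq_sym (negPf (neq_lift _ _)).
Qed.

Lemma derivation_det_log n (A J C : 'M[R]_n) :
  map_mx del A = J *m A + A *m C ->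
  del (\det A) = (\tr J + \tr C) * \det A.
Proof.
move=> dA; rewrite derivation_det dA mulmxDl linearD /= -mulmxA mul_mx_adj.
rewrite [in X in _ + X]mxtrace_mulC mulmxA mul_adj_mx mul_mx_scalar mul_scalar_mx.
by rewrite !linearZ /= mulrDl ![\det A * _]mulrC.
Qed.

End Jacobi.

Section LogarithmicFields.
Variables (k : fieldType) (Q : quiver) (d : dimvec Q).
Let R := coord_ring k d.
Variable b : 'I_(rep_dim d) -> gl k d.
Hypothesis pglb : pgl_basis b.

(** The fundamental vector field of [b i] for the action of the group on the representation
    space. *)
Definition log_field (i : 'I_(rep_dim d)) (p : R) : R :=
  \sum_j dtilde_mx b j i * p^`M(j).

Lemma log_fieldX i j : log_field i 'X_j = dtilde_mx b j i.
Proof.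
rewrite /log_field (bigD1 j) //= mderiv_var eqxx mulr1 big1 ?addr0 // => l lj.
by rewrite mderiv_var eq_sym (negPf lj) mulr0.
Qed.

Lemma log_fieldD i p q : log_field i (p + q) = log_field i p + log_field i q.
Proof.
by rewrite -big_split; apply: eq_bigr => j _; rewrite mderivD mulrDr.
Qed.

Lemma log_fieldM i p q :
  log_field i (p * q) = log_field i p * q + p * log_field i q.
Proof.
rewrite /log_field mulr_suml mulr_sumr -big_split; apply: eq_bigr => j _ /=.
by rewrite mderivM mulrDr; congr (_ + _); [rewrite mulrA | rewrite mulrCA].
Qed.

Lemma log_fieldC i c : log_field i c%:MP = 0.
Proof. by rewrite /log_field big1 // => j _; rewrite mderivC mulr0. Qed.

Lemma log_field_universal i a :
  map_mx (log_field i) (universal_rep k d a) =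
  defect (gl_ext (b i)) (universal_rep k d) a.
Proof.
apply/matrixP=> u w; rewrite mxE [universal_rep _ _ _ _ _]mxE log_fieldX.
by rewrite dtilde_mxE defect_mxE enum_rankK.
Qed.

(* [log_field i] maps the column [b_j M] of the matrix to [b_j (b_i M)],
   which is [b_i (b_j M) + (b_j b_i - b_i b_j) M]. *)
Lemma log_field_det i : exists w,
  log_field i (\det (dtilde_mx b)) = w * \det (dtilde_mx b).
Proof.
pose U := universal_rep k d; pose be j := gl_ext (b j); pose del := log_field i.
have be_const j x : map_mx del (be j x) = 0.
  by apply/matrixP=> u w; rewrite !mxE; apply: log_fieldC.
have [J JE] : exists J, forall u : 'rV[R]_(rep_dim d),
    fam_vec (defect (be i) (fam_of_vec u)) = u *m J.
  apply: linear_row_mx => c u w; rewrite -fam_vecZ -fam_vecD.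
  apply: fam_vec_eq => a; rewrite /defect !(fam_of_vecD, fam_of_vecZ).
  by rewrite mulmxDl mulmxDr -!scalemxAl -!scalemxAr scalerBr opprD addrACA.
(* Structure constants of pgl: brackets of basis elements expand in the basis up to a scalar, and
   scalars act trivially. *)
have /fin_all_exists[C CE] : forall j, exists C : ('I_(rep_dim d) -> k) * k,
    forall x, b j x *m b i x - b i x *m b j x = \sum_l C.1 l *: b l x + C.2%:M.
  move=> j; have [spanb _] := pglb.
  by have [c [s cs]] := spanb (fun x => b j x *m b i x - b i x *m b j x);
    exists (c, s).
pose c j l : R := ((C j).1 l)%:MP.
have comm j x : be j x *m be i x - be i x *m be j x =
    \sum_l c j l *: be l x + ((C j).2%:MP)%:M.
  rewrite -[be j x]/(map_mx (@mpolyC _ k) (b j x)).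
  rewrite -[be i x]/(map_mx (@mpolyC _ k) (b i x)) -!map_mxM -map_mxB CE map_mxD.
  rewrite map_mx_sum map_scalar_mx; congr (_ + _).
  by apply: eq_bigr => l _; rewrite map_mxZ.
have del_defect j a : map_mx del (defect (be j) U a) =
    defect (be i) (defect (be j) U) a + \sum_l c j l *: defect (be l) U a.
  have -> : \sum_l c j l *: defect (be l) U a =
      defect (fun x => be j x *m be i x - be i x *m be j x) U a.
    by rewrite -defect_sum -[LHS](defect_scalar _ (C j).2%:MP) /defect !comm.
  rewrite -defect_commutator.
  have map_mxI m n (A : 'M[R]_(m, n)) : map_mx id A = A.
    by apply/matrixP=> u w; rewrite mxE.
  have dM m n p (A : 'M[R]_(m, n)) (B : 'M[R]_(n, p)) :
      map_mx del (A *m B) = map_mx del A *m B + A *m map_mx del B.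
    rewrite (@map_mx_deriv _ _ del id) ?map_mxI //; first exact: log_fieldD.
    exact: log_fieldM.
  have dB m n (A B : 'M[R]_(m, n)) : map_mx del (A - B) = map_mx del A - map_mx del B.
    apply/matrixP=> u w; rewrite !mxE [LHS]log_fieldD; congr (_ + _).
    by apply/eqP; rewrite -addr_eq0 -log_fieldD addNr -mpolyC0 log_fieldC.
  rewrite [LHS]dB !dM !be_const mul0mx mulmx0 add0r addr0.
  by rewrite /defect !log_field_universal.
exists (\tr J^T + \tr (\matrix_(l, j) c j l)).
apply: derivation_det_log; [exact: log_fieldD | exact: log_fieldM |].
apply/matrixP=> r j.
have colE l : fam_vec (defect (be l) U) 0 r = dtilde_mx b r l.
  by rewrite dtilde_mxE [RHS]mxE.
have -> : map_mx (log_field i) (dtilde_mx b) r j =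
    fam_vec (fun a => map_mx del (defect (be j) U a)) 0 r.
  by rewrite [LHS]mxE -colE [RHS]mxE [RHS]mxE; congr (log_field _ _); rewrite mxE.
rewrite (fam_vec_eq (del_defect j)) fam_vecD [LHS]mxE [RHS]mxE; congr (_ + _).
  have -> : fam_vec (defect (be i) (defect (be j) U)) =
      fam_vec (defect (be i) (fam_of_vec (fam_vec (defect (be j) U)))).
    by apply: fam_vec_eq => a; rewrite /defect fam_vecK.
  rewrite JE mxE mxE; apply: eq_bigr => l _; rewrite mulrC; congr (_ * _).
    by rewrite [RHS]mxE.
  by rewrite dtilde_mxE [RHS]mxE.
rewrite [RHS]mxE [LHS]mxE summxE; apply: eq_bigr => l _.
by rewrite [LHS]mxE mulrC -colE; congr (_ * _); rewrite [RHS]mxE.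
Qed.

End LogarithmicFields.

Lemma log_field_der_log (k : fieldType) (Q : quiver) (d : dimvec Q)
    (b : 'I_(rep_dim d) -> gl k d) i :
  pgl_basis b -> der_log (\det (dtilde_mx b)) (log_field b i).
Proof.
move=> pglb; split.
  split=> [c p q|p q]; last exact: log_fieldM.
  by rewrite log_fieldD -mul_mpolyC log_fieldM log_fieldC mul0r add0r mul_mpolyC.
move=> _ [r ->]; have [w wE] := log_field_det pglb i.
by exists (log_field b i r + r * w); rewrite log_fieldM wE mulrDl mulrA.
Qed.

(* Saito's criterion.  By Cramer's rule a logarithmic [chi] is a combination of
   the columns of [A] with coefficients [det A' / Delta], [A'] being obtained
   from [A] by replacing a column by [chi]; as all columns of [A'] are
   logarithmic, [Delta] divides every [det A' * dDelta/dx_j]. *)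
Lemma saito_criterion (k : fieldType) n (A : 'M[{mpoly k[n]}]_n)
    (delta : 'I_n -> {mpoly k[n]} -> {mpoly k[n]}) :
  let Delta := \det A in
  Delta != 0 ->
  (forall h, (forall j, in_principal Delta (h * Delta^`M(j))) ->
     in_principal Delta h) ->
  (forall i p, delta i p = \sum_j A j i * p^`M(j)) ->
  (forall i, der_log Delta (delta i)) -> der_log_basis Delta delta.
Proof.
move=> Delta Delta0 grad deltaE logd; split=> //.
- move=> chi [[chi_lin chiM] chi_log].
  have chi0 : chi 0 = 0.
    have := chi_lin 1 0 0; rewrite !scale1r addr0 => /(congr1 (+%R (- chi 0))).
    by rewrite addNr addKr.
  have chiD p q : chi (p + q) = chi p + chi q.
    by have := chi_lin 1 p q; rewrite !scale1r.
  have chiC c : chi c%:MP = 0.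
    have chi1 : chi 1 = 0.
      by apply: (addrI (chi 1)); rewrite addr0 -[in RHS](mulr1 1) chiM mulr1 mul1r.
    by have := chi_lin c 1 0; rewrite !addr0 chi0 addr0 chi1 scaler0 alg_mpolyC.
  have chiE p : chi p = \sum_j chi 'X_j * p^`M(j).
    exact: (@derivationE n k _ idfun chi chiD chiM chiC).
  pose v : 'cV_n := \col_j chi 'X_j.
  have cramer i : in_principal Delta ((\adj A *m v) i 0).
    apply: grad => j0.
    pose A' := \matrix_(j, l) (if l == i then v j 0 else A j l).
    have -> : (\adj A *m v) i 0 = \det A'.
      rewrite (expand_det_col _ i) mxE; apply: eq_bigr => j _.
      rewrite [A' _ _]mxE eqxx mulrC [\adj A _ _]mxE; congr (_ * (_ * \det _)).
      by apply/matrixP=> u w; rewrite !mxE eq_sym (negPf (neq_lift _ _)).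
    pose g : 'rV_n := \row_j Delta^`M(j).
    have /fin_all_exists[w wE] : forall l, exists w, (g *m A') 0 l = w * Delta.
      move=> l; have [D_log [w wE]] : exists D, der_log Delta D /\
          (g *m A') 0 l = D Delta.
        have [li|li] := eqVneq l i.
          exists chi; split=> //; rewrite chiE mxE; apply: eq_bigr => j _.
          by rewrite !mxE li eqxx mulrC.
        exists (delta l); split=> //; rewrite deltaE mxE; apply: eq_bigr => j _.
        by rewrite !mxE (negPf li) mulrC.
      rewrite wE; apply: w.2; exists 1; rewrite mul1r //.
    exists ((\row_l w l *m \adj A') 0 j0).
    have gA' : g *m A' = Delta *: \row_l w l.
      by apply/rowP=> l; rewrite wE !mxE mulrC.
    have : (g *m A' *m \adj A') 0 j0 = (g *m (\det A')%:M) 0 j0.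
      by rewrite -mulmxA mul_mx_adj.
    by rewrite gA' -scalemxAl mxE mul_mx_scalar [RHS]mxE [g _ _]mxE mulrC => <-.
  have [s sE] := fin_all_exists cramer; exists s => p.
  have As j : \sum_i A j i * s i = v j 0.
    have : (A *m (\adj A *m v)) j 0 = Delta * v j 0.
      by rewrite mulmxA mul_mx_adj mul_scalar_mx mxE.
    rewrite mxE => E; apply: (mulfI Delta0); rewrite -E mulr_sumr.
    by apply: eq_bigr => i _; rewrite sE mulrCA [Delta * _]mulrC.
  rewrite chiE; under [RHS]eq_bigr do rewrite deltaE mulr_sumr.
  rewrite exchange_big; apply: eq_bigr => j _ /=.
  have -> : chi 'X_j = v j 0 by rewrite mxE.
  rewrite -As mulr_suml; apply: eq_bigr => i _.
  by rewrite mulrA [s i * _]mulrC.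
- move=> r rel i.
  have : \adj A *m (A *m (\col_i r i)) = 0.
    rewrite (_ : A *m _ = 0) ?mulmx0 //; apply/colP=> j; rewrite !mxE.
    rewrite -[RHS](rel 'X_j); apply: eq_bigr => l _; rewrite mxE mulrC deltaE.
    congr (_ * _); rewrite (bigD1 j) //= mderiv_var eqxx mulr1 big1 ?addr0 // => u uj.
    by rewrite mderiv_var eq_sym (negPf uj) mulr0.
  rewrite mulmxA mul_adj_mx mul_scalar_mx => /colP/(_ i); rewrite !mxE => /eqP.
  by rewrite mulf_eq0 (negPf Delta0) => /eqP.
Qed.

Lemma dtilde_mx_homog (k : fieldType) (Q : quiver) (d : dimvec Q)
    (b : 'I_(rep_dim d) -> gl k d) j i : dtilde_mx b j i \is 1.-homog.
Proof.
rewrite dtilde_mxE defect_mxE; move: (tag _) (tagged _) => a [u w] /=.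
have homX x y : universal_rep k d a x y \is 1.-homog.
  by rewrite mxE dhomogX; apply/eqP/mdeg1.
rewrite /defect mxE [X in _ + X]mxE rpredB // mxE rpred_sum // => l _.
  by rewrite mxE mul_mpolyC rpredZ.
by rewrite mulrC [map_mx _ _ _ _]mxE mul_mpolyC rpredZ.
Qed.

Lemma dtilde_mx_at0 (k : fieldType) (Q : quiver) (d : dimvec Q)
    (b : 'I_(rep_dim d) -> gl k d) :
  map_mx (meval (fun=> 0)) (dtilde_mx b) = 0.
Proof.
rewrite dtilde_mxE map_defect_mx; apply/matrixP=> j i; rewrite defect_mxE.
have U0 a : map_mx (meval (fun=> 0)) (universal_rep k d a) = 0.
  by apply/matrixP=> x y; rewrite !mxE mevalXU.
by rewrite /defect !U0 mulmx0 mul0mx subrr !mxE.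
Qed.

(** A basis of a linear complement of the diagonal scalars; the dimension hypothesis, which is q(d)
    = 1, gives it as many members as there are coordinates. *)
Lemma pgl_basis_exists (k : fieldType) (Q : quiver) (d : dimvec Q) :
  (exists x, d x <> 0%N) -> (\sum_x d x * d x = (rep_dim d).+1)%N ->
  exists b : 'I_(rep_dim d) -> gl k d, pgl_basis b.
Proof.
move=> d0 dimd; pose I : 'rV[k]_#|fam_idx d d| := fam_vec (fun x => 1%:M).
have I0 : I != 0.
  have [x dx] := d0; apply/eqP => I0.
  have /(congr1 mxrank) := fam_vec_inj (etrans I0 (esym (fam_of_vecK 0))) x.
  by rewrite fam_of_vec0 mxrank1 mxrank0.
have rkC : \rank (I^C)%MS = rep_dim d.
  by rewrite mxrank_compl rank_rV I0 card_fam_idx dimd subn1.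
have [B fB BE] : exists2 B : 'M[k]_(rep_dim d, #|fam_idx d d|),
    row_free B & (B :=: I^C)%MS.
  rewrite -rkC; exists (row_base (I^C)%MS); first exact: row_base_free.
  exact: eq_row_base.
have comb (c : 'I_(rep_dim d) -> k) x :
    \sum_i c i *: fam_of_vec (row i B) x = fam_of_vec ((\row_i c i) *m B) x.
  rewrite mulmx_sum_row fam_of_vec_sum; apply: eq_bigr => i _.
  by rewrite fam_of_vecZ mxE.
exists (fun i => fam_of_vec (row i B)); split=> [psi|c s h i].
  have : (fam_vec psi <= I + I^C)%MS by rewrite submx_full // addsmx_compl_full.
  case/sub_addsmxP=> -[u w] /= uw.
  have /submxP[c cE] : (w *m (I^C)%MS <= B)%MS by rewrite BE submxMl.
  exists (fun i => c 0 i), (u 0 0) => x.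
  rewrite comb (_ : \row_i c 0 i = c); last by apply/rowP=> i; rewrite mxE.
  rewrite -[LHS](fam_vecK psi x) uw cE fam_of_vecD addrC [u]mx11_scalar.
  by rewrite mul_scalar_mx fam_of_vecZ fam_vecK mxE eqxx mulr1n scalemx1.
have E : (\row_i c i) *m B = s *: I.
  rewrite -[LHS]fam_of_vecK -fam_vecZ; apply: fam_vec_eq => x.
  by rewrite -comb h scalemx1.
have : ((\row_i c i) *m B <= I :&: I^C)%MS.
  by rewrite sub_capmx -BE submxMl andbT E scalemx_sub.
rewrite capmx_compl submx0 mulmx_free_eq0 // => /eqP/rowP/(_ i).
by rewrite !mxE.
Qed.

Theorem corollary5p5 (k : closedFieldType) (k_char0 : [pchar k] =i pred0)
    (Q : quiver) (d : dimvec Q)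
    (Q_dynkin : dynkin_quiver Q) (d_real_root : real_root k d)
    (Rep_neq0 : (0 < rep_dim d)%N) :
  (exists Delta : coord_ring k d, discriminant_eq Delta) /\
  (forall Delta : coord_ring k d,
     discriminant_eq Delta -> linear_free_divisor Delta).
Proof.
have tits := dynkin_quiver_tits_positive Q_dynkin.
have [v [indv _]] := d_real_root; have [d0 _] := indv.
have brv := indecomposable_brick tits indv.
have rigv := brick_rigid tits d0 brv.
have dimd := rigid_brick_dim d0 brv rigv.
split.
  have [b pglb] := @pgl_basis_exists k Q d d0 (etrans dimd (congr1 S (esym (card_fam_idx _ _)))).
  by exists (\det (dtilde_mx b)), b.
move=> _ [b [pglb ->]].
have v_unit : defect_mx id b v \in unitmx.
  by rewrite unitmxE unitfE (defect_mx_rigid_unit idfun).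
have [tr trv] := translation_exists (fun l => fam_vec v 0 l).
have dim_le := eq_leq dimd.
have Delta0 : \det (dtilde_mx b) != 0.
  have := translate_det_neq0 v_unit trv.
  by apply: contra => /eqP ->; rewrite rmorph0.
split.
  split; first exact/eqP.
  (* A unit stays a unit at the origin, where all entries, being linear forms, vanish. The matrix
     must be nonempty here, as the empty determinant is 1. *)
  - apply/negP => /unitrP[r [_ /(congr1 (meval (fun=> 0)))]].
    rewrite mevalM meval1 -det_map_mx dtilde_mx_at0.
    have -> : \det (0 : 'M[k]_(rep_dim d)) = 0.
      by rewrite -(scale0r 1%:M) detZ expr0n eqn0Ngt Rep_neq0 mul0r.
    by rewrite mul0r => /eqP; rewrite eq_sym oner_eq0.
  - exact: (discriminant_radical k_char0 tits dim_le d0 pglb v_unit trv).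
exists (rep_dim d), (log_field b); split.
  apply: saito_criterion => //; last by move=> i; apply: log_field_der_log.
  exact: (discriminant_dvd_grad k_char0 tits dim_le d0 pglb v_unit trv).
by move=> i j; rewrite log_fieldX dtilde_mx_homog.
Qed.
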